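(* Let $\pi$ be a Borel probability measure on $(0,\infty)$. Let $d\ge1$ and let $(M_n,\mathcal F_n)_{n\ge0}$ be a martingale in $\mathbb R^d$ with $M_0=0$ and increments $X_n=M_n-M_{n-1}$ satisfying $\mathbb E[X_n\mid\mathcal F_{n-1}]=0$ and $\|X_n\|\le1$ a.s. for all $n\ge1$, where $\|\cdot\|$ is the Euclidean norm. Write $V_n=\sum_{i=1}^n\mathbb E[X_iX_i^{\top}\mid\mathcal F_{i-1}]$. For every $y\ge0$, with probability at least $1-e^{-y}$, simultaneously for all $n\ge1$ with $\lambda_{\min}(V_n)>0$, all $r>0$ and all $u>1$, writing \[ L_{n,r,u}=y+\Delta_\pi\bigl(r\lambda_{\min}(V_n),u\bigr)+\frac12\log\det\bigl(I+(r\lambda_{\min}(V_n))^{-1}V_n\bigr), \] one has \[ \|V_n^{-1/2}M_n\|\le\sqrt{1+r}\,\Bigl(\sqrt{2uL_{n,r,u}}+\frac{L_{n,r,u}}{3\sqrt{r\lambda_{\min}(V_n)}}\Bigr). \]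
   Context: $\lambda_{\min}(A)$ denotes the smallest eigenvalue of a symmetric matrix $A$. For $a>0$ and $u>1$, $\Delta_\pi(a,u)=-\log\pi([a,ua])$, with the convention $-\log0=\infty$ (in which case the bound is trivial). *)

(* Defs.v *)
From HB Require Import structures.
From mathcomp Require Import all_boot all_order all_algebra.
From mathcomp Require Import all_classical all_reals all_analysis.

Set Implicit Arguments.
Unset Strict Implicit.
Unset Printing Implicit Defensive.

Import Order.TTheory GRing.Theory Num.Theory.
Import numFieldNormedType.Exports.

Local Open Scope classical_set_scope.
Local Open Scope ring_scope.

(* The canonical norm of the library on column vectors is the sup norm. *)
Definition enorm (R : realType) (d : nat) (x : 'cV[R]_d) : R :=
  Num.sqrt (\sum_(i < d) x i ord0 ^+ 2).

(* A symmetric matrix of positive size has a nonempty finite set of real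
   eigenvalues, so the infimum is then a minimum. *)
Definition lambda_min (R : realType) (d : nat) (A : 'M[R]_d) : R :=
  inf [set a : R | eigenvalue A a].

Definition psdmx (R : realType) (d : nat) (A : 'M[R]_d) : Prop :=
  A^T = A /\ forall x : 'cV[R]_d, 0 <= (x^T *m A *m x) ord0 ord0.

(* The unique positive semidefinite square root of A when A is positive
   semidefinite, and 0 if there is none. *)
Definition sqrtmx (R : realType) (d : nat) (A : 'M[R]_d) : 'M[R]_d :=
  xget 0 [set S : 'M[R]_d | psdmx S /\ S *m S = A].

Definition inv_sqrtmx (R : realType) (d : nat) (A : 'M[R]_d) : 'M[R]_d :=
  invmx (sqrtmx A).

Section Martingales.
Context {disp : measure_display} {T : measurableType disp} {R : realType}.
Variable P : probability T R.

Definition filtration (F : nat -> set (set T)) : Prop :=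
  [/\ forall n, sigma_algebra [set: T] (F n),
      forall n, F n `<=` measurable &
      forall m n, (m <= n)%N -> F m `<=` F n].

Definition measurable_wrt (G : set (set T)) (Y : T -> R) : Prop :=
  forall B : set R, measurable B -> G (Y @^-1` B).

(* Y is a version of the conditional expectation E[X | G]. *)
Definition cond_exp_version (G : set (set T)) (X Y : T -> R) : Prop :=
  [/\ P.-integrable [set: T] (EFin \o X),
      measurable_wrt G Y,
      P.-integrable [set: T] (EFin \o Y) &
      forall A, G A ->
        (\int[P]_(w in A) (Y w)%:E = \int[P]_(w in A) (X w)%:E)%E].

Definition cond_exp_version_mx (p q : nat) (G : set (set T))
    (X Y : T -> 'M[R]_(p, q)) : Prop :=
  forall i j, cond_exp_version G (fun w => X w i j) (fun w => Y w i j).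

Definition martingale (d : nat) (F : nat -> set (set T))
    (M : nat -> T -> 'cV[R]_d) : Prop :=
  [/\ forall n i, measurable_wrt (F n) (fun w => M n w i ord0),
      forall n i, P.-integrable [set: T] (fun w => (M n w i ord0)%:E) &
      forall n, cond_exp_version_mx (F n) (M n.+1) (M n)].

End Martingales.

(* X_n = M_n - M_{n-1}; only used for n >= 1. *)
Definition increment (T : Type) (R : realType) (d : nat)
    (M : nat -> T -> 'cV[R]_d) (n : nat) (w : T) : 'cV[R]_d :=
  M n w - M n.-1 w.

(* -log pi([a, u a]), with value +oo when pi([a, u a]) = 0. *)
Definition Delta (R : realType) (pi : probability (measurableTypeR R) R)
    (a u : R) : \bar R :=
  (- lne (pi `[a, (u * a)%R]%classic))%E.

(* L_{n,r,u} as a function of the value V of V_n. *)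
Definition Lbound (R : realType) (pi : probability (measurableTypeR R) R)
    (d : nat) (V : 'M[R]_d) (y r u : R) : \bar R :=
  let a := r * lambda_min V in
  (y%:E + Delta pi a u + (2^-1 * ln (\det (1%:M + a^-1 *: V)))%:E)%E.

(* Main.v *)
(**
Let [h x = (1 + x) ln (1 + x) - x] be Bennett's function. For every [rho > 0],
with [N_n = I + V_n / rho], the process
[[
  det(N_n)^(-1/2) * exp (rho * h (sqrt (M_n^T N_n^-1 M_n) / rho))
]]
is a nonnegative supermartingale started at 1. It is not obtained as a mixture
of the exponential supermartingales indexed by a dual vector [theta]: it is
checked directly.

The one-step inequality splits in two. First, with the predictable matrix
[N_n] fixed, the dependence of the potential on the increment [x], [|x| <= 1],
is dominated by a quadratic polynomial in [x]
([bennett_increment], [potential_increment]); conditioning replaces [x] by [0]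
and [x x^T] by its conditional covariance. Second, the resulting compensator
is absorbed when [N_n] is replaced by [N_(n-1)], by convexity of [h],
Cauchy-Schwarz, and [det B <= exp (tr B - d)] for positive definite [B]
([potential_compensator]).

Integrating over [rho] against [pi] and applying Ville's inequality bounds all
the mixtures by [e^y] at once. For [rho] in [[a, u a]] the potential is at
least [det(I + V/a)^(-1/2) exp (u a h (w / (u a)))] with
[w^2 = M^T (I + V/a)^-1 M], so [u a h (w / (u a)) <= L], and
[x <= sqrt (2 h x) + h x / 3] turns this into the Bernstein form; finally
[V^-1 <= (1 + r) (V + a I)^-1] for [a = r lambda_min V].
*)
Require Import Defs.
From HB Require Import structures.
From mathcomp Require Import all_boot all_order all_algebra.
From mathcomp Require Import all_classical all_reals all_analysis.
From mathcomp Require Import measurable_realfun ring lra.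
Import Order.TTheory GRing.Theory Num.Theory.
Import numFieldNormedType.Exports.
Local Open Scope classical_set_scope.
Local Open Scope ring_scope.

Set Implicit Arguments.
Unset Strict Implicit.
Unset Printing Implicit Defensive.

(** The quadratic majorant has little freedom. Once conditioned, its second-order part is the trace
    of N^-1 C over 2 rho plus a rank-one term, ln (1 + u) / u times theta^T C theta over 2 rho^2,
    where theta = N^-1 M, u is the scaled norm of M and C the conditional covariance. To first order
    in C, the determinant factor of the potential pays exactly for the trace, and the drop of M^T
    N^-1 M as N grows pays exactly for the rank-one term. The coefficients of the majorant are
    dictated by these two payments, so the scalar inequality behind it is delicate near u = 0 and
    calls for sharp bounds on the logarithm. The mixture over rho is there because the useful value,
    r lambda_min(V_n), is random and unknown in advance; the exceptional event then involves neither
    r nor u. The matrix facts are obtained by elimination and by Cauchy-Schwarz between a form and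
    its inverse, without diagonalisation. Integrability of the potential is never assumed:
    supermartingale inequalities are stated between integrals of nonnegative functions over events
    of the past. *)

(** * Elementary bounds on exp and ln *)

Section ScalarInequalities.
Variable R : realType.
Implicit Types (x y u l c eta : R).

Lemma is_derive_ln_comp (f : R -> R) x df : 0 < f x -> is_derive x 1 f df ->
  is_derive x 1 (fun t => ln (f t)) ((f x)^-1 * df).
Proof. by move=> f0 fd; apply: is_derive1_comp; exact: is_derive1_ln. Qed.

Lemma is_derive_ln1D x : 0 < 1 + x -> is_derive x 1 (fun t => ln (1 + t)) (1 + x)^-1.
Proof.
move=> x0; rewrite -[(1 + x)^-1]mulr1; apply: is_derive_ln_comp => //.
by apply: is_derive_eq; rewrite add0r.
Qed.

Lemma le_of_derive_ge0 (f df : R -> R) (a b : R) : a <= b ->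
  (forall x, a <= x <= b -> is_derive x 1 f (df x)) ->
  (forall x, a <= x <= b -> 0 <= df x) -> f a <= f b.
Proof.
rewrite le_eqVlt => /predU1P[->//|ab] fd df0.
have [x|x|c] := @MVT R f df a b ab.
- by rewrite in_itv/= => /andP[ax xb]; apply: fd; rewrite !ltW.
- apply: derivable_within_continuous => z; rewrite in_itv/= => zab.
  by have /@ex_derive := fd _ zab.
- rewrite in_itv/= => /andP[ac cb] fE.
  by rewrite -subr_ge0 fE mulr_ge0 ?subr_ge0 ?(ltW ab)// df0// !ltW.
Qed.

(** Convexity of [expR]: the tangent at [eta * c] is evaluated at [c] and at 0, and the weights
    [eta] and [1 - eta] cancel its slope. *)
Lemma expR_chord eta c : 0 <= eta <= 1 -> expR (eta * c) <= 1 + eta * (expR c - 1).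
Proof.
move=> /andP[e0 e1].
have h1 : expR (eta * c) * (1 + (1 - eta) * c) <= expR c.
  have -> : expR c = expR (eta * c) * expR ((1 - eta) * c).
    by rewrite -expRD; congr expR; ring.
  by rewrite ler_pM2l ?expR_gt0// expR_ge1Dx.
have h2 : expR (eta * c) * (1 - eta * c) <= 1.
  rewrite -[leRHS](expRxMexpNx_1 (eta * c)) ler_pM2l ?expR_gt0//.
  by rewrite expR_ge1Dx.
have := ler_wpM2l e0 h1; have := @ler_wpM2l _ (1 - eta) _ _ _ h2.
rewrite subr_ge0 => /(_ e1); lra.
Qed.

Lemma ln1D_chord eta x : 0 <= eta <= 1 -> 0 <= x ->
  eta * ln (1 + x) <= ln (1 + eta * x).
Proof.
move=> e01 x0; have e0 : 0 <= eta by case/andP: e01.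
rewrite -ler_expR lnK ?posrE; last by nra.
apply: le_trans (expR_chord _ e01) _.
by rewrite lnK ?posrE; nra.
Qed.

Lemma ln_ge1Vx x : 0 < x -> 1 - x^-1 <= ln x.
Proof.
move=> x0; have := @le_ln1Dx R (x^-1 - 1).
rewrite (_ : 1 + (x^-1 - 1) = x^-1); last by ring.
by rewrite lnV ?posrE// ltrDr invr_gt0 => /(_ x0); lra.
Qed.

(** The rational function is the [2/2] Pade approximant of the logarithm at 0, which is why the
    numerator of [df] collapses to [t ^+ 4]. *)
Lemma ln1D_pade x : 0 <= x ->
  3 * x * (x + 2) / (x ^+ 2 + 6 * x + 6) <= ln (1 + x).
Proof.
move=> x0.
pose f (t : R) := ln (1 + t) - 3 * t * (t + 2) / (t ^+ 2 + 6 * t + 6).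
pose df (t : R) := t ^+ 4 / ((1 + t) * (t ^+ 2 + 6 * t + 6) ^+ 2).
suff : f 0 <= f x by rewrite /f addr0 ln1 mulr0 mul0r mul0r; lra.
apply: (@le_of_derive_ge0 f df _ _ x0) => t /andP[t0 tx].
  rewrite /f /df.
  have p1 : 0 < 1 + t by lra.
  have p2 : t ^+ 2 + 6 * t + 6 != 0 by apply/lt0r_neq0; nra.
  have dln := is_derive_ln1D p1.
  apply: is_derive_eq.
  rewrite /GRing.scale/=; field.
  by rewrite p2 lt0r_neq0.
by rewrite divr_ge0 ?exprn_ge0// mulr_ge0 ?sqr_ge0//; lra.
Qed.
End ScalarInequalities.

(** * Bennett's function: convexity, comparison and inversion *)

Section BennettFunction.
Variable R : realType.
Implicit Types (x y u l c eta : R).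

(** The trapezoidal rule for the convex function 1 / (1 + t) on [0, x]. *)
Lemma ln1D_le_mid x : 0 <= x -> ln (1 + x) <= x * (2 + x) / (2 * (1 + x)).
Proof.
move=> x0.
pose f (t : R) := t * (2 + t) / (2 * (1 + t)) - ln (1 + t).
pose df (t : R) := t ^+ 2 / (2 * (1 + t) ^+ 2).
suff : f 0 <= f x by rewrite /f !addr0 ln1 !mul0r; lra.
apply: (@le_of_derive_ge0 _ f df _ _ x0) => t /andP[t0 tx]; last first.
  by rewrite divr_ge0 ?sqr_ge0// mulr_ge0 ?sqr_ge0.
rewrite /f /df.
have p1 : 0 < 1 + t by lra.
have p2 : 2 * (1 + t) != 0 by apply/lt0r_neq0; lra.
have dln := is_derive_ln1D p1.
apply: is_derive_eq.
rewrite /GRing.scale/=; field.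
by rewrite lt0r_neq0.
Qed.

(** Bennett's observation that (exp x - 1 - x) / x^2 is nondecreasing, compared at [eta * l] and
    [l]. Differentiating in [l] reduces it to [expR_chord]. *)
Lemma expR_quad_chord eta l : 0 <= eta <= 1 -> 0 <= l ->
  expR (eta * l) <= 1 + eta * l + eta ^+ 2 * (expR l - 1 - l).
Proof.
move=> e01 l0; have /andP[e0 e1] := e01.
pose f (t : R) := 1 + eta * t + eta ^+ 2 * (expR t - 1 - t) - expR (eta * t).
pose df (t : R) := eta * (1 + eta * (expR t - 1) - expR (eta * t)).
suff : f 0 <= f l by rewrite /f !mulr0 expR0; lra.
apply: (@le_of_derive_ge0 _ f df _ _ l0) => t /andP[t0 tx]; last first.
  by rewrite mulr_ge0// subr_ge0 expR_chord.
rewrite /f /df.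
have de : is_derive t 1 (fun s => expR (eta * s)) (expR (eta * t) * eta).
  apply: is_derive1_comp; apply: is_derive_eq.
  by rewrite /GRing.scale/= mulr1.
apply: is_derive_eq.
rewrite /GRing.scale/=; ring.
Qed.

Definition bennett x := (1 + x) * ln (1 + x) - x.

Lemma is_derive_bennett x : 0 < 1 + x -> is_derive x 1 bennett (ln (1 + x)).
Proof.
move=> x0; have dln := is_derive_ln1D x0.
rewrite /bennett; apply: is_derive_eq.
rewrite /GRing.scale/=; field.
by rewrite lt0r_neq0.
Qed.

Lemma bennett0 : bennett 0 = 0.
Proof. by rewrite /bennett addr0 ln1; ring. Qed.

Lemma bennett_tangent x y : -1 < x -> -1 < y ->
  ln (1 + x) * (y - x) <= bennett y - bennett x.
Proof.
move=> x0 y0.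
have p1 : 0 < 1 + x by lra.
have p2 : 0 < 1 + y by lra.
have := @ln_ge1Vx R ((1 + y) / (1 + x)).
rewrite ln_div ?posrE// divr_gt0// => /(_ isT) /(ler_wpM2l (ltW p2)).
rewrite invf_div mulrBr mulrCA divff ?lt0r_neq0// /bennett; lra.
Qed.

Lemma bennett_ge0 x : 0 <= x -> 0 <= bennett x.
Proof.
move=> x0; have := @bennett_tangent 0 x; rewrite bennett0 addr0 ln1 mul0r subr0.
by apply; lra.
Qed.

Lemma bennett_homo x y : 0 <= x -> x <= y -> bennett x <= bennett y.
Proof.
move=> x0 xy; rewrite -subr_ge0; apply: le_trans (@bennett_tangent x y _ _); try lra.
by rewrite mulr_ge0 ?subr_ge0 ?ln_ge0//; lra.
Qed.

Lemma bennett_scale c x : 0 <= c <= 1 -> 0 <= x -> bennett (c * x) <= c * bennett x.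
Proof.
move=> /andP[c0 c1] x0.
have cx0 : 0 <= c * x by rewrite mulr_ge0.
have h1 : ln (1 + c * x) * (x - c * x) <= bennett x - bennett (c * x).
  by apply: bennett_tangent; lra.
have h2 : ln (1 + c * x) * (0 - c * x) <= bennett 0 - bennett (c * x).
  by apply: bennett_tangent; lra.
rewrite bennett0 in h2.
have := ler_wpM2l c0 h1; have c1' : 0 <= 1 - c by lra.
have := ler_wpM2l c1' h2; lra.
Qed.

(** Convexity and [bennett0] make q h(c / q) nonincreasing in q, so that all [rho] in an interval
    can be compared with its right end. *)
Lemma bennett_perspective (p q c : R) : 0 < p -> p <= q -> 0 <= c ->
  q * bennett (c / q) <= p * bennett (c / p).
Proof.
move=> p0 pq c0; have q0 : 0 < q := lt_le_trans p0 pq.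
have -> : c / q = p / q * (c / p) by field; rewrite !lt0r_neq0.
have pq1 : 0 <= p / q <= 1.
  by rewrite ler_pdivrMr// mul1r pq andbT divr_ge0// ltW.
have /(bennett_scale pq1) : 0 <= c / p by rewrite divr_ge0// ltW.
move=> /(ler_wpM2l (ltW q0)); rewrite [leRHS]mulrA.
by rewrite [q * (p / q)]mulrC divfK ?lt0r_neq0.
Qed.

(** The derivative ln (1 + t) is concave, so its mean over [x, y] is at most its value at the
    midpoint. *)
Lemma bennett_midpoint x y : 0 <= x -> x <= y ->
  bennett y - bennett x <= (y - x) * ln (1 + (x + y) / 2).
Proof.
move=> x0 xy.
pose f (t : R) := (t - x) * ln (1 + (x + t) / 2) - bennett t.
pose df (t : R) := ln (1 + (x + t) / 2) + (t - x) / 2 / (1 + (x + t) / 2) - ln (1 + t).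
suff : f x <= f y by rewrite /f subrr mul0r; lra.
apply: (@le_of_derive_ge0 _ f df _ _ xy) => t /andP[xt ty].
  have p1 : 0 < 1 + t by lra.
  have p2 : 0 < 1 + (x + t) / 2 by lra.
  have db := is_derive_bennett p1.
  have dm : is_derive t 1 (fun s => 1 + (x + s) / 2) (2^-1).
    by apply: is_derive_eq; rewrite /GRing.scale/=; ring.
  have dl := @is_derive_ln_comp R (fun s => 1 + (x + s) / 2) t _ p2 dm.
  rewrite /f /df; apply: is_derive_eq.
  rewrite /GRing.scale/=; field.
  by apply/lt0r_neq0; lra.
rewrite /df.
have p2 : 0 < 1 + (x + t) / 2 by lra.
have := @le_ln1Dx R ((t - x) / 2 / (1 + (x + t) / 2)).
have -> : 1 + (t - x) / 2 / (1 + (x + t) / 2) = (1 + t) / (1 + (x + t) / 2).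
  by field; apply/lt0r_neq0; lra.
rewrite ln_div ?posrE//; last lra.
have : 0 <= (t - x) / 2 / (1 + (x + t) / 2) by rewrite divr_ge0//; lra.
by move=> ? /(_ ltac:(lra)); lra.
Qed.

(** As a function of t^2, [bennett] has the derivative ln (1 + t) / (2 t), which is nonincreasing;
    this is the tangent inequality of that concave function at x^2. *)
Lemma bennett_sqr_chord x y : 0 <= y -> y <= x ->
  ln (1 + x) * (x ^+ 2 - y ^+ 2) <= 2 * x * (bennett x - bennett y).
Proof.
move=> y0 yx.
pose f (t : R) := 2 * x * (bennett t - bennett y) - ln (1 + x) * (t ^+ 2 - y ^+ 2).
pose df (t : R) := 2 * (x * ln (1 + t) - t * ln (1 + x)).
suff : f y <= f x by rewrite /f !subrr !mulr0; lra.
apply: (@le_of_derive_ge0 _ f df _ _ yx) => t /andP[yt tx].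
  have p1 : 0 < 1 + t by lra.
  have db := is_derive_bennett p1.
  rewrite /f /df; apply: is_derive_eq.
  rewrite /GRing.scale/=; ring.
rewrite mulr_ge0// subr_ge0.
have [x0|x0] := eqVneq x 0.
  have -> : t = 0 by lra.
  by rewrite x0 !mul0r.
have x0' : 0 < x by rewrite lt0r x0; lra.
have tx1 : 0 <= t / x <= 1.
  by rewrite ler_pdivrMr// mul1r tx andbT divr_ge0; lra.
have := ler_wpM2l (ltW x0') (ln1D_chord tx1 (ltW x0')).
by rewrite [leLHS]mulrA [x * (_ / _)]mulrC divfK.
Qed.

(** The classical minorant 9 (1 + x / 3 - sqrt (1 + 2 x / 3)) of Bennett's function equals 9/2 (w -
    1)^2 for w = sqrt (1 + 2 x / 3). With this minorant in place of [bennett x] the claim is an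
    equality, since 3 (w - 1) + 3/2 (w - 1)^2 = x. *)
Lemma bennett_inversion x : 0 <= x -> x <= Num.sqrt (2 * bennett x) + bennett x / 3.
Proof.
move=> x0; pose w := Num.sqrt (1 + 2 * x / 3).
have w1 : 1 <= w by rewrite -[leLHS]sqrtr1 ler_sqrt; lra.
have w2 : w ^+ 2 = 1 + 2 * x / 3 by rewrite sqr_sqrtr//; lra.
have xE : x = 3 / 2 * (w ^+ 2 - 1) by rewrite w2; field.
have p (t : R) : 1 <= t -> 0 < 1 + 3 / 2 * (t ^+ 2 - 1) by move=> t1; nra.
(* In the variable w, the two sides of [hb] have derivatives 9 (w - 1) and 3 w ln (1 + x); comparing
   them is this bound. *)
have lnb (s : R) : 1 <= s -> 3 * (1 - s^-1) <= ln (1 + 3 / 2 * (s ^+ 2 - 1)).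
  move=> s1.
  pose f (t : R) := ln (1 + 3 / 2 * (t ^+ 2 - 1)) - 3 * (1 - t^-1).
  pose df (t : R) := 3 * (t - 1) ^+ 2 * (2 * t + 1) / (t ^+ 2 * (3 * t ^+ 2 - 1)).
  suff : f 1 <= f s by rewrite /f !expr1n invr1 !subrr !mulr0 addr0 ln1; lra.
  apply: (@le_of_derive_ge0 _ f df _ _ s1) => t /andP[t1 _]; last first.
    by rewrite divr_ge0 ?mulr_ge0 ?sqr_ge0//; nra.
  have t0 : t != 0 by apply/lt0r_neq0; lra.
  have dv : is_derive t 1 (fun s => s^-1) (- t ^- 2).
    split; first by apply: derivableV => //; exact: derivable_id.
    by rewrite deriveV// derive_id /GRing.scale/= mulr1.
  have dm : is_derive t 1 (fun s => 1 + 3 / 2 * (s ^+ 2 - 1)) (3 * t).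
    by apply: is_derive_eq; rewrite /GRing.scale/=; field.
  have dl := @is_derive_ln_comp R (fun s => 1 + 3 / 2 * (s ^+ 2 - 1)) t _ (p t t1) dm.
  rewrite /f /df; apply: is_derive_eq.
  rewrite /GRing.scale/=; field.
  by repeat (apply/andP; split); apply/lt0r_neq0; nra.
have hb : 9 / 2 * (w - 1) ^+ 2 <= bennett x.
  pose f (t : R) := bennett (3 / 2 * (t ^+ 2 - 1)) - 9 / 2 * (t - 1) ^+ 2.
  pose df (t : R) := ln (1 + 3 / 2 * (t ^+ 2 - 1)) * (3 * t) - 9 * (t - 1).
  suff : f 1 <= f w by rewrite /f -xE !expr1n !subrr expr0n/= !mulr0 bennett0; lra.
  apply: (@le_of_derive_ge0 _ f df _ _ w1) => t /andP[t1 _]; last first.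
    have t0 : 0 < t by lra.
    have := ler_wpM2l (ltW t0) (lnb t t1).
    have -> : t * (3 * (1 - t^-1)) = 3 * (t - 1) by field; rewrite lt0r_neq0.
    rewrite /df; lra.
  have dm : is_derive t 1 (fun s => 3 / 2 * (s ^+ 2 - 1)) (3 * t).
    by apply: is_derive_eq; rewrite /GRing.scale/=; field.
  have db : is_derive t 1 (fun s => bennett (3 / 2 * (s ^+ 2 - 1)))
      (ln (1 + 3 / 2 * (t ^+ 2 - 1)) * (3 * t)).
    exact: (@is_derive1_comp R bennett (fun s => 3 / 2 * (s ^+ 2 - 1)) t _ _
             (is_derive_bennett (p t t1)) dm).
  rewrite /f /df; apply: is_derive_eq.
  by rewrite /GRing.scale/=; field.
have : 3 * (w - 1) <= Num.sqrt (2 * bennett x).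
  rewrite -[leLHS]ger0_norm; last lra.
  have hb2 : (3 * (w - 1)) ^+ 2 <= 2 * bennett x .
    have -> : (3 * (w - 1)) ^+ 2 = 2 * (9 / 2 * (w - 1) ^+ 2) by field.
    by rewrite ler_pM2l.
  by rewrite -sqrtr_sqr ler_sqrt//; exact: le_trans (sqr_ge0 _) hb2.
lra.
Qed.

End BennettFunction.

(** * The one-dimensional inequality for an increment *)

Section KeyInequality.
Variable R : realType.

(** All that [key_polynomial_ge0] needs to know about the logarithm. The first bound is the
    trapezoidal rule divided by [u]. In the last one both sides are u^2 to leading order: the
    simpler approximant 2 u / (u + 2) of the logarithm would require (4 + 3 u)^2 <= 8 (1 + u) (2 +
    u), which fails by u^2, hence [ln1D_pade]. *)
Lemma ln1D_slope_bounds (u : R) : 0 < u ->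
  let l := ln (1 + u) in let g := 1 - l / u in let m := u / (1 + u) in
  [/\ m <= 2 * g, 0 <= g <= 1 & (g + m / 2) ^+ 2 <= l * m].
Proof.
move=> u0 l g m.
have u1 : 0 < 1 + u by lra.
have Q0 : 0 < u ^+ 2 + 6 * u + 6 by nra.
have l0 : 0 <= l by rewrite ln_ge0//; lra.
have hp : 3 * u * (u + 2) / (u ^+ 2 + 6 * u + 6) <= l by apply: ln1D_pade; lra.
have hg : g <= u * (u + 3) / (u ^+ 2 + 6 * u + 6).
  have -> : u * (u + 3) / (u ^+ 2 + 6 * u + 6) =
            1 - 3 * u * (u + 2) / (u ^+ 2 + 6 * u + 6) / u.
    by field; rewrite !lt0r_neq0.
  by rewrite lerD2l lerN2 ler_pM2r ?invr_gt0.
have m0 : 0 <= m by rewrite divr_ge0 ?ltW.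
have mg : m <= 2 * g.
  have := @ln1D_le_mid R u (ltW u0).
  rewrite -(@ler_pM2r _ u^-1) ?invr_gt0// -/l => h.
  have -> : m = 2 * (1 - u * (2 + u) / (2 * (1 + u)) / u).
    by rewrite /m; field; rewrite !lt0r_neq0.
  by rewrite ler_pM2l// lerD2l lerN2.
have g0 : 0 <= g by lra.
split=> //; first by rewrite g0 /g gerBl divr_ge0// ltW.
apply: (@le_trans _ _ (3 * u * (u + 2) / (u ^+ 2 + 6 * u + 6) * m)); last first.
  by rewrite ler_wpM2r.
apply: (@le_trans _ _ ((u * (u + 3) / (u ^+ 2 + 6 * u + 6) + m / 2) ^+ 2)).
  by rewrite ler_sqr ?nnegrE; nra.
rewrite -subr_ge0 /m.
have -> : 3 * u * (u + 2) / (u ^+ 2 + 6 * u + 6) * (u / (1 + u)) -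
  (u * (u + 3) / (u ^+ 2 + 6 * u + 6) + u / (1 + u) / 2) ^+ 2 =
  u ^+ 3 * (24 + 44 * u + 24 * u ^+ 2 + 3 * u ^+ 3) /
    (2 * (1 + u) * (u ^+ 2 + 6 * u + 6)) ^+ 2.
  by field; rewrite !lt0r_neq0.
by rewrite divr_ge0 ?sqr_ge0// mulr_ge0 ?exprn_ge0 ?(ltW u0)//; nra.
Qed.

(* Here [g], [l], [m] stand for [1 - ln (1 + u) / u], [ln (1 + u)] and
   [u / (1 + u)]; up to a nonnegative term, [2 * l] times the left-hand side is
   [(l (e - k) - e (l - B))^2 + e^2 (l m - B^2)] with [B = g + m / 2]. *)
Lemma key_polynomial_ge0 (e k g l m : R) : 0 <= k -> k <= e -> e <= 1 -> 0 < l ->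
  0 <= m -> m <= 2 * g -> (g + m / 2) ^+ 2 <= l * m ->
  0 <= g * e * (1 - e) + l * k ^+ 2 / 2 - g * k + e ^+ 2 * (e - k) * m / (1 + e).
Proof.
move=> k0 ke e1 l0 m0 mg hB.
have e1' : 0 < 1 + e by lra.
rewrite -(@pmulr_rge0 _ (2 * l)) ?mulr_gt0//.
set B := g + m / 2 in hB *.
set C := e ^+ 2 * m / (1 + e).
have hC : 0 <= g + C - e * B.
  have -> : g + C - e * B = (1 - e) * ((2 * g - m) * e + 2 * g) / (2 * (1 + e)).
    by rewrite /C /B; field; rewrite lt0r_neq0.
  rewrite divr_ge0 ?mulr_ge0//; nra.
have -> : 2 * l * (g * e * (1 - e) + l * k ^+ 2 / 2 - g * k + e ^+ 2 * (e - k) * m / (1 + e)) =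
  (l * (e - k) - e * (l - B)) ^+ 2 + e ^+ 2 * (l * m - B ^+ 2) +
  2 * l * (e - k) * (g + C - e * B).
  by rewrite /B /C; field; rewrite lt0r_neq0.
rewrite !addr_ge0 ?sqr_ge0//; first by rewrite mulr_ge0 ?sqr_ge0 ?subr_ge0.
by rewrite !mulr_ge0//; lra.
Qed.

Lemma expR_le_quad (x : R) : x <= 0 -> expR x <= 1 + x + x ^+ 2 / 2.
Proof.
move=> x0.
pose f (t : R) := expR t - (1 + t + t ^+ 2 / 2).
pose df (t : R) := expR t - (1 + t).
suff : f x <= f 0 by rewrite /f expR0 expr0n/=; lra.
apply: (@le_of_derive_ge0 _ f df _ _ x0) => t /andP[xt t0]; last first.
  by rewrite subr_ge0 expR_ge1Dx.
rewrite /f /df; apply: is_derive_eq.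
by rewrite /GRing.scale/=; field.
Qed.

(** When the norm decreases, concavity of [bennett] in the squared norm bounds the exponent by
    [b * K] with [K <= 0]. For a nonpositive argument the second Taylor polynomial dominates exp,
    and [b <= 1] with [k <= K <= 0] does the rest. *)
Lemma bennett_increment_neg (v u u' k s : R) : 0 < v -> 0 <= u -> 0 <= u' ->
  u' <= u -> u' ^+ 2 = u ^+ 2 + 4 * v * k + 2 * v * s -> 0 <= s ->
  expR ((bennett u' - bennett u) / (2 * v)) <=
  1 + ln (1 + u) / u * k + s / 2 + ln (1 + u) / u * k ^+ 2 / 2.
Proof.
move=> v0 u0 u'0 u'u uE s0; set b := ln (1 + u) / u.
have [u_eq0|u_neq0] := eqVneq u 0.
  have -> : u' = u by lra.
  rewrite subrr mul0r expR0 /b u_eq0 addr0 ln1 !mul0r; lra.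
have up : 0 < u by rewrite lt0r u_neq0.
have b0 : 0 <= b by rewrite divr_ge0 ?ln_ge0//; lra.
have b1 : b <= 1.
  by rewrite ler_pdivrMr// mul1r le_ln1Dx//; lra.
set K := k + s / 2.
have K0 : K <= 0.
  rewrite -(@pmulr_rle0 _ (4 * v)) ?mulr_gt0//.
  have -> : 4 * v * K = u' ^+ 2 - u ^+ 2 by rewrite uE /K; field.
  by rewrite subr_le0 ler_sqr.
have hK : (bennett u' - bennett u) / (2 * v) <= b * K.
  rewrite ler_pdivrMr ?mulr_gt0//.
  have -> : b * K * (2 * v) = - (ln (1 + u) * (u ^+ 2 - u' ^+ 2) / (2 * u)).
    by rewrite uE /K /b; field.
  rewrite lerNr opprB ler_pdivrMr ?mulr_gt0// [leRHS]mulrC.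
  exact: bennett_sqr_chord.
apply: le_trans (_ : expR (b * K) <= _); first by rewrite ler_expR.
apply: le_trans (expR_le_quad _) _; first by rewrite mulr_ge0_le0.
have kK : k <= K by rewrite /K; lra.
have k2 : b * K ^+ 2 <= k ^+ 2 by nra.
have -> : 1 + b * K + (b * K) ^+ 2 / 2 =
  1 + b * k + b * (s / 2) + b * (b * K ^+ 2) / 2 by rewrite /K; field.
have := ler_wpM2l b0 k2; nra.
Qed.

(** The hard case, where exp exceeds its second Taylor polynomial: the bound has to come from the
    slack in convexity of exp between 0 and [l], together with the bound 1 on the increment. *)
Lemma bennett_increment_pos (v u u' k s : R) : 0 < v -> 0 <= u ->
  u <= u' -> u' ^+ 2 = u ^+ 2 + 4 * v * k + 2 * v * s -> 0 <= s -> s <= 2 * v ->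
  2 * v * k ^+ 2 <= u ^+ 2 * s ->
  expR ((bennett u' - bennett u) / (2 * v)) <=
  1 + ln (1 + u) / u * k + s / 2 + ln (1 + u) / u * k ^+ 2 / 2.
Proof.
move=> v0 u0 uu' uE s0 sv cs; set b := ln (1 + u) / u.
have u1 : 0 < 1 + u by lra.
set l := ln (1 + u) in b *.
(* In the application [t] is the length of X in the metric of N^-1, and [e] below the growth of the
   length of M. Then [et] is the triangle inequality, and [kE] expresses the scalar product through
   lengths. *)
pose t := Num.sqrt (s / (2 * v)).
have t0 : 0 <= t by exact: sqrtr_ge0.
have tE : s = 2 * v * t ^+ 2.
  by rewrite sqr_sqrtr ?divr_ge0//; [field; rewrite lt0r_neq0|lra].
have t1 : t <= 1.
  rewrite -[leRHS]sqrtr1 ler_sqrt// ler_pdivrMr ?mulr_gt0//; lra.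
have kt : k <= u * t.
  have : k ^+ 2 <= (u * t) ^+ 2.
    rewrite -(@ler_pM2l _ (2 * v)) ?mulr_gt0//; move: cs; rewrite tE; lra.
  have := mulr_ge0 u0 t0; nra.
pose e := (u' - u) / (2 * v).
have u'E : u' = u + 2 * v * e by rewrite /e; field; rewrite lt0r_neq0.
have e0 : 0 <= e by rewrite divr_ge0 ?subr_ge0//; lra.
have et : e <= t.
  have : u' ^+ 2 <= (u + 2 * v * t) ^+ 2 by rewrite uE tE; nra.
  rewrite ler_sqr; [|by rewrite nnegrE; lra|by rewrite nnegrE; nra].
  by rewrite u'E lerD2l ler_pM2l ?mulr_gt0.
have e01 : 0 <= e <= 1 by rewrite e0 (le_trans et).
have kE : k = e * u - v * (t ^+ 2 - e ^+ 2).
  apply: (@mulfI _ (4 * v)); first by rewrite lt0r_neq0 ?mulr_gt0.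
  move: uE; rewrite u'E tE; lra.
have lK : expR l = 1 + u by rewrite lnK.
clearbody e t.
set E := expR (e * l).
have E1 : E <= 1 + e * u.
  by have := expR_chord l e01; rewrite lK -/E; lra.
have Egt0 : 0 < E by exact: expR_gt0.
(* The midpoint bound gives the exponent e ln (1 + u + v e). Splitting off the factor 1 + u leaves
   [E] times a power with exponent [e] in [0, 1], linearised by [expR_chord]. *)
have LHS : expR ((bennett u' - bennett u) / (2 * v)) <= E + e ^+ 2 * v * (E / (1 + u)).
  have y0 : 0 <= e * v / (1 + u) by rewrite divr_ge0 ?mulr_ge0 ?(ltW v0) ?(ltW u1).
  apply: (@le_trans _ _ (expR (e * ln (1 + (u + u') / 2)))).
    rewrite ler_expR ler_pdivrMr ?mulr_gt0//.
    have := bennett_midpoint u0 uu'.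
    by rewrite {2}u'E; lra.
  have -> : 1 + (u + u') / 2 = (1 + u) * (1 + e * v / (1 + u)).
    by rewrite u'E; field; rewrite lt0r_neq0.
  rewrite lnM ?posrE//; last lra.
  rewrite mulrDr expRD -/l -/E.
  apply: (@le_trans _ _ (E * (1 + e * (e * v / (1 + u))))); last by nra.
  rewrite ler_pM2l//.
  have := expR_chord (ln (1 + e * v / (1 + u))) e01.
  by rewrite lnK ?posrE; lra.
apply: le_trans LHS _.
have [u_eq0|u_neq0] := eqVneq u 0.
  have l_eq0 : l = 0 by rewrite /l u_eq0 addr0 ln1.
  have -> : E = 1 by rewrite /E l_eq0 mulr0 expR0.
  rewrite /b l_eq0 u_eq0 addr0 invr1 !mul0r tE; nra.
have up : 0 < u by rewrite lt0r u_neq0.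
have l0 : 0 < l by rewrite ln_gt0//; lra.
have [mg /andP[g0 g1] hB] := @ln1D_slope_bounds u up.
rewrite -/l -/b in mg g0 g1 hB.
set g := 1 - b in mg g0 g1 hB.
set m := u / (1 + u) in mg hB.
have m0 : 0 <= m by rewrite divr_ge0 ?ltW.
have bu : b * u = l by rewrite /b divfK.
have b0 : 0 <= b by rewrite divr_ge0 ?ltW.
have gu : g * u = u - l by rewrite /g mulrBl mul1r bu.
rewrite -subr_ge0.
(* The slack of [expR_chord] at [l], bounded below through [expR_quad_chord]. *)
set W := 1 + e * u - E.
have W0 : e * (1 - e) * (g * u) <= W.
  have := expR_quad_chord e01 (ltW l0); rewrite lK -/E /W gu; lra.
have -> : 1 + b * k + s / 2 + b * k ^+ 2 / 2 - (E + e ^+ 2 * v * (E / (1 + u))) =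
  W - g * k + b * k ^+ 2 / 2 + e ^+ 2 * (v * ((1 + u - E) / (1 + u))).
  have -> : s / 2 = e * u + v * e ^+ 2 - k by rewrite kE tE; field.
  by rewrite /W /g; field; rewrite lt0r_neq0.
have hE : (1 - e) * m <= (1 + u - E) / (1 + u).
  by rewrite /m mulrA ler_pM2r ?invr_gt0//; lra.
clearbody m b.
have ve0 : 0 <= e ^+ 2 * (v * ((1 - e) * m)).
  by rewrite !mulr_ge0 ?sqr_ge0//; lra.
have hE' : e ^+ 2 * (v * ((1 - e) * m)) <= e ^+ 2 * (v * ((1 + u - E) / (1 + u))).
  by rewrite ler_wpM2l ?sqr_ge0// ler_wpM2l// ltW.
have [k0|k0] := leP k 0.
  have : 0 <= e * (1 - e) * (g * u) by rewrite !mulr_ge0//; lra.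
  have : g * k <= 0 by rewrite mulr_ge0_le0.
  have : 0 <= b * k ^+ 2 / 2 by rewrite divr_ge0// mulr_ge0// sqr_ge0.
  lra.
(* Dividing by [u] makes the inequality homogeneous, and [x] takes the place of [k] in
   [key_polynomial_ge0]. The term left over is controlled by [(e - x) * u = v * (t ^+ 2 - e ^+ 2)]
   and [t <= 1]. *)
pose x := k / u.
have kx : k = x * u by rewrite /x divfK.
have x0 : 0 <= x by rewrite divr_ge0// ltW.
have xe : x <= e.
  rewrite /x ler_pdivrMr// kE gerBl mulr_ge0 ?(ltW v0)// subr_ge0 ler_sqr ?nnegrE//.
have := key_polynomial_ge0 x0 xe _ l0 m0 mg hB.
move=> /(_ (le_trans et t1)) /(mulr_ge0 (ltW up)).
have ex : (e - x) * u <= v * (1 - e) * (1 + e).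
  have -> : (e - x) * u = v * (t ^+ 2 - e ^+ 2) by rewrite mulrBl -kx kE; ring.
  have : t ^+ 2 <= 1 by nra.
  by move=> h; rewrite -mulrA ler_pM2l//; lra.
have ex' : e ^+ 2 * ((e - x) * u) * m / (1 + e) <= e ^+ 2 * (v * ((1 - e) * m)).
  rewrite ler_pdivrMr; last lra.
  have := ler_wpM2l (mulr_ge0 (sqr_ge0 e) m0) ex; lra.
have -> : b * k ^+ 2 / 2 = u * (l * x ^+ 2 / 2) by rewrite kx -bu; field.
have -> : g * k = u * (g * x) by rewrite kx; ring.
have -> : u * (g * e * (1 - e) + l * x ^+ 2 / 2 - g * x + e ^+ 2 * (e - x) * m / (1 + e)) =
  e * (1 - e) * (g * u) + u * (l * x ^+ 2 / 2) - u * (g * x) + 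
  e ^+ 2 * ((e - x) * u) * m / (1 + e).
  by field; rewrite lt0r_neq0//; lra.
lra.
Qed.

(* In the application [v = 1 / (2 rho)], [u] and [u'] are the norms of [M] and
   [M + X] in the metric of [N^-1], divided by [rho], [k] is the scalar product
   of [M] and [X] divided by [rho], and [s] the squared norm of [X] divided by
   [rho]; the last hypothesis is the Cauchy-Schwarz inequality. At [u = 0] the
   quotient [ln (1 + u) / u] is 0 instead of its limit 1, which is harmless
   since then [k = 0]. *)
Lemma bennett_increment (v u u' k s : R) : 0 < v -> 0 <= u -> 0 <= u' ->
  u' ^+ 2 = u ^+ 2 + 4 * v * k + 2 * v * s -> 0 <= s -> s <= 2 * v ->
  2 * v * k ^+ 2 <= u ^+ 2 * s ->
  expR ((bennett u' - bennett u) / (2 * v)) <=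
  1 + ln (1 + u) / u * k + s / 2 + ln (1 + u) / u * k ^+ 2 / 2.
Proof.
move=> v0 u0 u'0 uE s0 sv cs; have [uu'|/ltW u'u] := leP u u'.
  exact: bennett_increment_pos.
exact: bennett_increment_neg.
Qed.

End KeyInequality.

(** * Quadratic forms and positive definite matrices *)

Section QuadraticForms.
Variable R : realType.
Implicit Types d : nat.

Definition bform d (A : 'M[R]_d) (x y : 'cV[R]_d) : R := (x^T *m A *m y) ord0 ord0.

Definition qform d (A : 'M[R]_d) (x : 'cV[R]_d) : R := bform A x x.

Definition pdmx d (A : 'M[R]_d) : Prop :=
  A^T = A /\ forall x : 'cV[R]_d, x != 0 -> 0 < qform A x.

Lemma bformDl d (A : 'M[R]_d) x y z : bform A (x + y) z = bform A x z + bform A y z.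
Proof. by rewrite /bform linearD/= !mulmxDl mxE. Qed.

Lemma bformDr d (A : 'M[R]_d) x y z : bform A z (x + y) = bform A z x + bform A z y.
Proof. by rewrite /bform mulmxDr mxE. Qed.

Lemma bformZl d (A : 'M[R]_d) a x y : bform A (a *: x) y = a * bform A x y.
Proof. by rewrite /bform linearZ/= -!scalemxAl mxE. Qed.

Lemma bformZr d (A : 'M[R]_d) a x y : bform A x (a *: y) = a * bform A x y.
Proof. by rewrite /bform -scalemxAr mxE. Qed.

Lemma bform0r d (A : 'M[R]_d) x : bform A x 0 = 0.
Proof. by rewrite /bform mulmx0 mxE. Qed.

Lemma bform_sym d (A : 'M[R]_d) x y : A^T = A -> bform A x y = bform A y x.
Proof.
move=> As; rewrite /bform -[in LHS](trmxK (x^T *m A *m y)) mxE.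
by rewrite !trmx_mul trmxK As mulmxA.
Qed.

Lemma bform_sumE d (A : 'M[R]_d) x y :
  bform A x y = \sum_i \sum_j A i j * (x i ord0 * y j ord0).
Proof.
rewrite /bform mxE exchange_big/=; apply: eq_bigr => j _.
rewrite mxE big_distrl/=; apply: eq_bigr => i _; rewrite mxE; ring.
Qed.

Lemma bformDm d (A B : 'M[R]_d) x y : bform (A + B) x y = bform A x y + bform B x y.
Proof. by rewrite /bform mulmxDr mulmxDl mxE. Qed.

Lemma bformZm d a (A : 'M[R]_d) x y : bform (a *: A) x y = a * bform A x y.
Proof. by rewrite /bform -scalemxAr -scalemxAl mxE. Qed.

Lemma bform_congr d n (A : 'M[R]_d) (L : 'M[R]_(n, d)) x y :
  bform (L *m A *m L^T) x y = bform A (L^T *m x) (L^T *m y).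
Proof. by rewrite /bform trmx_mul trmxK !mulmxA. Qed.

Lemma bform_invmx d (A : 'M[R]_d) x y : A \in unitmx ->
  bform A x (invmx A *m y) = bform 1%:M x y.
Proof. by move=> Au; rewrite /bform mulmx1 !mulmxA mulmxK. Qed.

Lemma qform_invmx d (A : 'M[R]_d) x : A \in unitmx -> A^T = A ->
  qform A (invmx A *m x) = qform (invmx A) x.
Proof.
move=> Au As; rewrite /qform bform_invmx// /bform.
by rewrite trmx_mul trmx_inv As mulmx1.
Qed.

Lemma qform1E d (x : 'cV[R]_d) : qform 1%:M x = \sum_i x i ord0 ^+ 2.
Proof.
rewrite /qform /bform mulmx1 mxE; apply: eq_bigr => i _.
by rewrite mxE expr2.
Qed.

Lemma enormE d (x : 'cV[R]_d) : enorm x = Num.sqrt (qform 1%:M x).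
Proof. by rewrite /enorm qform1E. Qed.

Lemma qform1_ge0 d (x : 'cV[R]_d) : 0 <= qform 1%:M x.
Proof. by rewrite qform1E sumr_ge0// => i _; rewrite sqr_ge0. Qed.

Lemma qform1_eq0 d (x : 'cV[R]_d) : (qform 1%:M x == 0) = (x == 0).
Proof.
rewrite qform1E psumr_eq0; last by move=> i _; rewrite sqr_ge0.
apply/allP/eqP => [h|-> i _]; last by rewrite /= mxE expr0n eqxx.
apply/matrixP => i j; rewrite mxE ord1; apply/eqP.
by move/(_ i (mem_index_enum i)): h; rewrite /= sqrf_eq0.
Qed.

Lemma pdmx_psd d (A : 'M[R]_d) : pdmx A -> psdmx A.
Proof.
move=> [As Ap]; split => // x; have [->|x0] := eqVneq x 0.
  by rewrite mulmx0 mxE.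
exact: ltW (Ap x x0).
Qed.

Lemma psdmx_qform d (A : 'M[R]_d) x : psdmx A -> 0 <= qform A x.
Proof. by move=> [_]; apply. Qed.

Lemma pdmx1 d : pdmx (1%:M : 'M[R]_d).
Proof.
split=> [|x x0]; first by rewrite trmx1.
by rewrite lt0r qform1_eq0 x0 qform1_ge0.
Qed.

Lemma pdmxD d (A B : 'M[R]_d) : pdmx A -> psdmx B -> pdmx (A + B).
Proof.
move=> [As Ap] [Bs Bp]; split; first by rewrite linearD/= As Bs.
by move=> x x0; rewrite /qform bformDm ltr_pwDl// ?Ap//; exact: Bp.
Qed.

Lemma psdmxD d (A B : 'M[R]_d) : psdmx A -> psdmx B -> psdmx (A + B).
Proof.
move=> [As Ap] [Bs Bp]; split; first by rewrite linearD/= As Bs.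
move=> x; have := addr_ge0 (Ap x) (Bp x).
by rewrite -[_ + _]/(qform A x + qform B x) -bformDm.
Qed.

Lemma psdmxZ d a (A : 'M[R]_d) : 0 <= a -> psdmx A -> psdmx (a *: A).
Proof.
move=> a0 [As Ap]; split; first by rewrite linearZ/= As.
by move=> x; have := mulr_ge0 a0 (Ap x); rewrite -[_ * _]bformZm.
Qed.

Lemma psdmx0 d : psdmx (0 : 'M[R]_d).
Proof. by split=> [|x]; rewrite ?trmx0// mulmx0 mul0mx mxE. Qed.

Lemma pdmx_congr d (A L : 'M[R]_d) : L \in unitmx -> pdmx A -> pdmx (L *m A *m L^T).
Proof.
move=> Lu [As Ap]; split; first by rewrite !trmx_mul trmxK As mulmxA.
move=> x x0; rewrite /qform bform_congr Ap//; apply: contra_neq x0 => Lx.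
by rewrite -(mul1mx x) -(mulVmx (_ : L^T \in unitmx)) ?unitmx_tr// -mulmxA Lx mulmx0.
Qed.

Lemma pdmx_unit d (A : 'M[R]_d) : pdmx A -> A \in unitmx.
Proof.
move=> [As Ap]; rewrite -row_free_unit -kermx_eq0; apply/eqP/row_matrixP => i.
rewrite row0; apply/eqP; rewrite -trmx_eq0; apply: contraT => /Ap.
rewrite /qform /bform trmxK -row_mul mulmx_ker row0 mul0mx mxE ltxx//.
Qed.

Lemma psdmx_cauchy_schwarz d (A : 'M[R]_d) x y : psdmx A ->
  bform A x y ^+ 2 <= qform A x * qform A y.
Proof.
move=> Ap; have As := Ap.1.
have qf (t : R) : 0 <= qform A x + 2 * t * bform A x y + t ^+ 2 * qform A y.
  have := psdmx_qform (x + t *: y) Ap.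
  rewrite /qform bformDl !bformDr !bformZl !bformZr (bform_sym y x As); lra.
have x0 := psdmx_qform x Ap; have y0 := psdmx_qform y Ap.
set a := qform A x in qf x0 *; set b := bform A x y in qf *; set c := qform A y in qf y0 *.
have [c0|c0] := eqVneq c 0.
  have [->|b0] := eqVneq b 0; first by rewrite expr0n/= mulr_ge0.
  (* With [c = 0] the polynomial in t is affine, and this t gives it the value -1. *)
  have := qf (- (a + 1) / (2 * b)); rewrite c0 mulr0 addr0.
  have -> : 2 * (- (a + 1) / (2 * b)) * b = - (a + 1) by field.
  lra.
have cp : 0 < c by rewrite lt0r c0.
have := qf (- b / c).
have -> : a + 2 * (- b / c) * b + (- b / c) ^+ 2 * c = (a * c - b ^+ 2) / c by field.
by rewrite pmulr_lge0 ?invr_gt0// subr_ge0.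
Qed.

Lemma pdmx_inv d (A : 'M[R]_d) : pdmx A -> pdmx (invmx A).
Proof.
move=> Ap; have Au := pdmx_unit Ap; split; first by rewrite trmx_inv Ap.1.
move=> x x0; rewrite -qform_invmx//; last exact: Ap.1.
apply: Ap.2; apply: contra_neq x0 => h.
by rewrite -(mulKVmx Au x) h mulmx0.
Qed.

(** The duality between a form and its inverse; it stands in for diagonalisation below. *)
Lemma dot_sqr_le d (A : 'M[R]_d) x y : pdmx A ->
  bform 1%:M x y ^+ 2 <= qform A x * qform (invmx A) y.
Proof.
move=> Ap; have Au := pdmx_unit Ap.
have := psdmx_cauchy_schwarz x (invmx A *m y) (pdmx_psd Ap).
by rewrite bform_invmx// qform_invmx//; exact: Ap.1.
Qed.

(** Duality for A at the vector B^-1 y bounds q^2, with q = y^T B^-1 y, by the value of A there,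
    which is at most q, times y^T A^-1 y; then q cancels. *)
Lemma qform_invmx_antitone d (A B : 'M[R]_d) y : pdmx A -> pdmx B ->
  (forall x, qform A x <= qform B x) -> qform (invmx B) y <= qform (invmx A) y.
Proof.
move=> Ap Bp AB; have Bu := pdmx_unit Bp.
have [->|y0] := eqVneq y 0; first by rewrite /qform !bform0r.
have q0 : 0 < qform (invmx B) y by apply: (pdmx_inv Bp).2.
have := dot_sqr_le (invmx B *m y) y Ap.
have -> : bform 1%:M (invmx B *m y) y = qform (invmx B) y.
  by rewrite /qform /bform trmx_mul trmx_inv Bp.1 mulmx1.
move=> h; rewrite -(@ler_pM2l _ (qform (invmx B) y))//.
apply: le_trans (_ : qform A (invmx B *m y) * qform (invmx A) y <= _); first by rewrite -expr2.
rewrite ler_wpM2r ?(psdmx_qform _ (pdmx_psd (pdmx_inv Ap)))//.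
by rewrite -(qform_invmx _ Bu) ?AB//; exact: Bp.1.
Qed.

End QuadraticForms.

(** * Elimination, determinants and the least eigenvalue *)

Section Determinants.
Variable R : realType.
Implicit Types d : nat.

(** One step of Gaussian elimination: [a] is the pivot and [S] the Schur complement. The trace drops
    by |v|^2 / a, with [v] the column below the pivot, so inductions can follow the determinant and
    the trace together. *)
Lemma pdmx_schur d (A : 'M[R]_(1 + d)) : pdmx A ->
  exists (a : R) (S L : 'M[R]_(_)),
    [/\ 0 < a, pdmx S, L \in unitmx, \det L = 1 &
        L *m A *m L^T = block_mx a%:M 0 0 S /\ a + \tr S <= \tr A].
Proof.
move=> Ap; have [As Apos] := Ap.
pose a := ulsubmx A ord0 ord0; pose v := dlsubmx A; pose B := drsubmx A.
have ulE : ulsubmx A = a%:M by rewrite [LHS]mx11_scalar.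
have urE : ursubmx A = v^T by rewrite /v trmx_dlsub As.
have AE : A = block_mx a%:M v^T v B by rewrite -[LHS]submxK ulE urE.
have a0 : 0 < a.
  have := Apos (col_mx 1%:M 0); rewrite /qform /bform AE tr_col_mx trmx0 trmx1.
  rewrite mul_row_block mul_row_col !mul1mx !mul0mx !mulmx0 mulmx1 !addr0.
  rewrite mxE eqxx mulr1n; apply.
  apply/eqP => /matrixP /(_ (lshift d ord0) ord0); rewrite col_mxEu !mxE eqxx.
  by move/eqP; rewrite oner_eq0.
pose S := B - a^-1 *: (v *m v^T).
pose L : 'M[R]_(1 + d) := block_mx 1%:M 0 (- a^-1 *: v) 1%:M.
have dL : \det L = 1 by rewrite det_lblock !det1 mulr1.
have Lu : L \in unitmx by rewrite unitmxE dL unitr1.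
have LAL : L *m A *m L^T = block_mx a%:M 0 0 S.
  rewrite AE /L tr_block_mx !trmx1 trmx0 linearZ/= mulmx_block.
  rewrite !mul1mx !mul0mx !addr0 -!scalemxAl mul_mx_scalar scalerA mulNr mulVf ?lt0r_neq0//.
  rewrite scaleN1r addNr mulmx_block !mul0mx !mulmx1 !mulmx0 !addr0 !add0r.
  rewrite mul_scalar_mx scalerA mulrN divff ?lt0r_neq0// scaleN1r addNr.
  by rewrite scaleNr addrC.
exists a, S, L; split=> //; last first.
  split=> //; rewrite AE mxtrace_block mxtrace_scalar mulr1n lerD2l /S linearB/= gerBl.
  rewrite linearZ/= mulr_ge0 ?invr_ge0 ?(ltW a0)// mxtrace_mulC trace_mx11.
  rewrite mxE sumr_ge0// => i _; rewrite mxE -expr2 sqr_ge0//.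
have Sp := pdmx_congr Lu Ap; rewrite LAL in Sp.
split; first by have := Sp.1; rewrite tr_block_mx => /eq_block_mx[_ _ _].
move=> x x0; have := Sp.2 (col_mx 0 x).
rewrite /qform /bform tr_col_mx trmx0 mul_row_block mul_row_col !mul0mx !mulmx0 !add0r.
by apply; apply: contra_neq x0; rewrite -[X in _ = X -> _]vsubmxK => /eq_col_mx[_ ->]; rewrite linear0.
Qed.

Lemma pdmx_cholesky d (A : 'M[R]_d) : pdmx A ->
  exists2 L : 'M[R]_d, L \in unitmx & L *m A *m L^T = 1%:M.
Proof.
elim: d A => [|d IH] A Ap.
  by exists 1%:M; [exact: unitmx1|apply/matrixP; case].
have [a [S [L0 [a0 Sp L0u _ [LAL _]]]]] := @pdmx_schur d A Ap.
have [L1 L1u LSL] := IH S Sp.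
pose D : 'M[R]_(1 + d) := block_mx (Num.sqrt a)^-1%:M 0 0 L1.
have sa : (Num.sqrt a)^-1 * (a * (Num.sqrt a)^-1) = 1.
  by rewrite mulrCA -invfM -expr2 sqr_sqrtr ?(ltW a0)// divff// lt0r_neq0.
exists (D *m L0).
  rewrite unitmx_mul L0u andbT.
  rewrite -[D \in _]/((D : 'M[R]_(1 + d)) \in unitmx) unitmxE det_ublock det_scalar expr1 unitrM.
  by rewrite -unitmxE L1u andbT unitfE invr_eq0 sqrtr_eq0 -ltNge.
rewrite trmx_mul -!mulmxA [X in D *m X](_ : _ = (L0 *m A *m L0^T) *m D^T); last first.
  by rewrite !mulmxA.
have blk (p q : R) (P Q : 'M[R]_d) :
    (block_mx p%:M 0 0 P : 'M[R]_(1 + d)) *m (block_mx q%:M 0 0 Q : 'M[R]_(1 + d)) =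
    block_mx (p * q)%:M 0 0 (P *m Q).
  by rewrite mulmx_block !mulmx0 !mul0mx !addr0 !add0r -scalar_mxM.
have -> : L0 *m A *m L0^T *m D^T = block_mx (a * (Num.sqrt a)^-1)%:M 0 0 (S *m L1^T).
  by rewrite LAL /D tr_block_mx !trmx0 tr_scalar_mx; exact: blk.
by rewrite /D; etransitivity; [exact: blk|rewrite sa mulmxA LSL -scalar_mx_block].
Qed.

Lemma pdmx_det_gt0 d (A : 'M[R]_d) : pdmx A -> 0 < \det A.
Proof.
move=> /pdmx_cholesky[L Lu /(congr1 determinant)]; rewrite !det_mulmx det_tr det1 => h.
have L0 : \det L != 0 by rewrite -unitfE -unitmxE.
have : 0 < \det L ^+ 2 by rewrite exprn_even_gt0.
move=> h2; rewrite -(pmulr_rgt0 _ h2) expr2 -mulrA [X in _ * X]mulrC mulrA h//.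
Qed.

(** The determinant is the product of the pivots, and each pivot satisfies a <= exp (a - 1). *)
Lemma pdmx_det_le d (A : 'M[R]_d) : pdmx A -> \det A <= expR (\tr A - d%:R).
Proof.
elim: d A => [|d IH] A Ap.
  by rewrite det_mx00 [\tr A]big_ord0 subr0 expR0.
have [a [S [L [a0 Sp _ dL [LAL trS]]]]] := @pdmx_schur d A Ap.
have -> : \det A = a * \det S.
  have := congr1 determinant LAL.
  by rewrite !det_mulmx det_tr dL mul1r mulr1 det_ublock det_scalar expr1.
apply: (@le_trans _ _ (expR (a - 1) * expR (\tr S - d%:R))).
  apply: ler_pM; rewrite ?(ltW a0)//; last exact: IH.
    exact: ltW (pdmx_det_gt0 Sp).
  by have := expR_ge1Dx (a - 1); rewrite addrC subrK.
rewrite -expRD ler_expR -[d.+1%:R]/((1 + d)%:R) natrD; move: trS; lra.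
Qed.

(** A congruence by [L] normalises A + C to the identity. Then A becomes I - L C L^T, whose trace is
    [d] minus the trace in the statement, and [pdmx_det_le] applies. *)
Lemma pdmx_det_ratio d (A C : 'M[R]_d) : pdmx A -> psdmx C ->
  \det A <= \det (A + C) * expR (- \tr (invmx (A + C) *m C)) /\
  0 <= \tr (invmx (A + C) *m C).
Proof.
move=> Ap Cp; have Bp := pdmxD Ap Cp.
have [L Lu LBL] := pdmx_cholesky Bp.
have LTu : L^T \in unitmx by rewrite unitmx_tr.
have BE : invmx (A + C) = L^T *m L.
  have BLL : (A + C) *m (L^T *m L) = 1%:M.
    by rewrite mulmxA; apply: mulmx1C; rewrite mulmxA.
  by rewrite -[LHS]mulmx1 -BLL mulKmx// pdmx_unit.
have trE : \tr (invmx (A + C) *m C) = \tr (L *m C *m L^T).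
  by rewrite BE [LHS]mxtrace_mulC mulmxA -[in RHS]mulmxA [RHS]mxtrace_mulC.
have LAL : L *m A *m L^T = 1%:M - L *m C *m L^T.
  by rewrite -LBL mulmxDr mulmxDl addrK.
split; last first.
  rewrite trE /mxtrace sumr_ge0// => i _.
  have := psdmx_qform (L^T *m delta_mx i ord0) Cp.
  rewrite /qform -bform_congr /bform trmx_delta -rowE -colE.
  by rewrite !mxE.
have := pdmx_det_le (pdmx_congr Lu Ap).
rewrite {2}LAL linearB/= mxtrace1 addrAC subrr sub0r -trE => h.
have := congr1 determinant LBL; rewrite !det_mulmx !det_tr det1 => dE.
rewrite !det_mulmx det_tr in h.
have -> : \det A = \det (A + C) * (\det L * \det A * \det L).
  by rewrite -[LHS]mul1r -dE; ring.
by rewrite ler_pM2l// pdmx_det_gt0.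
Qed.

Lemma pdmx_det_homo d (A C : 'M[R]_d) : pdmx A -> psdmx C -> \det A <= \det (A + C).
Proof.
move=> Ap Cp; have [h1 h2] := pdmx_det_ratio Ap Cp.
apply: le_trans h1 _; rewrite ler_piMr ?(ltW (pdmx_det_gt0 (pdmxD Ap Cp)))//.
by rewrite expR_le1 oppr_le0.
Qed.

(** The infimum [mu] of the Rayleigh quotient is shown to be an eigenvalue, hence an upper bound for
    [lambda_min V]. This also provides the nonemptiness without which [inf] would be a default
    value. *)
Lemma psdmx_lambda_min_le d (V : 'M[R]_d) x : psdmx V -> 0 < lambda_min V ->
  lambda_min V * qform 1%:M x <= qform V x.
Proof.
move=> Vp l0.
have [->|x0] := eqVneq x 0; first by rewrite /qform !bform0r mulr0.
pose Q := [set a : R | exists2 z, z != 0 & a = qform V z / qform 1%:M z].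
have q1 z : z != 0 -> 0 < qform (1%:M : 'M[R]_d) z by apply: (@pdmx1 _ _).2.
have Q0 : Q (qform V x / qform 1%:M x) by exists x.
have Qlb : lbound Q 0.
  by move=> _ [z z0 ->]; rewrite divr_ge0 ?(ltW (q1 z z0))//; exact: Vp.2.
have hinf : has_inf Q by split; [exists (qform V x / qform 1%:M x)|exists 0].
pose mu := inf Q.
have muP z : mu * qform 1%:M z <= qform V z.
  have [->|z0] := eqVneq z 0; first by rewrite /qform !bform0r mulr0.
  rewrite -ler_pdivlMr ?q1//; apply: ge_inf; last by exists z.
  by exists 0.
pose W := V - mu%:M.
have WE : W = V + (- mu) *: 1%:M by rewrite scaleNr scalemx1.
have qW z : qform W z = qform V z - mu * qform 1%:M z.
  by rewrite WE /qform bformDm bformZm mulNr.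
have Wp : psdmx W.
  split=> [|z]; first by rewrite linearB/= Vp.1 tr_scalar_mx.
  by rewrite -[_ ord0 ord0]/(qform W z) qW subr_ge0.
(* If V - mu I were invertible it would be positive definite, hence bounded below by some K^-1 > 0
   on unit vectors, and [mu] would not be the infimum. *)
have Wsing : W \notin unitmx.
  apply/negP => Wu.
  have Wpd : pdmx W.
    split; first exact: Wp.1.
    move=> z z0; rewrite lt0r (psdmx_qform z Wp) andbT.
    apply: contra_neq z0 => Wz.
    have := psdmx_cauchy_schwarz (invmx W *m z) z Wp.
    rewrite Wz mulr0 => h; apply/eqP; rewrite -qform1_eq0 -sqrf_eq0.
    have -> : qform 1%:M z = bform W (invmx W *m z) z.
      by rewrite bform_sym ?bform_invmx//; exact: Wp.1.
    by rewrite eq_le h sqr_ge0.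
  (* [K] bounds the form of W^-1 because |z_i z_j| <= |z|^2; duality turns this into the lower bound
     K^-1 for W. *)
  pose K := 1 + \sum_i \sum_j `|invmx W i j|.
  have K0 : 0 < K.
    by rewrite ltr_pwDl// sumr_ge0// => i _; rewrite sumr_ge0.
  have invK z : qform (invmx W) z <= K * qform 1%:M z.
    apply: (@le_trans _ _ (\sum_i \sum_j `|invmx W i j| * qform 1%:M z)).
      rewrite /qform [leLHS]bform_sumE; apply: ler_sum => i _; apply: ler_sum => j _.
      apply: le_trans (ler_norm _) _; rewrite normrM ler_wpM2l//.
      rewrite -/(qform _ _) qform1E.
      have zi (k : 'I_d) : z k ord0 ^+ 2 <= \sum_i0 z i0 ord0 ^+ 2.
        by rewrite (bigD1 k)//= lerDl sumr_ge0// => ? _; rewrite sqr_ge0.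
      have := zi i; have := zi j; rewrite normrM -[z i ord0 ^+ 2]real_normK ?num_real//.
      rewrite -[z j ord0 ^+ 2]real_normK ?num_real//.
      have := sqr_ge0 (`|z i ord0| - `|z j ord0|); nra.
    rewrite /K mulrDl mul1r big_distrl/= ler_wpDl ?qform1_ge0//.
    by apply: ler_sum => i _; rewrite big_distrl.
  have low z : z != 0 -> K^-1 <= qform W z / qform 1%:M z.
    move=> z0; rewrite ler_pdivlMr ?q1// ler_pdivrMl//.
    have := dot_sqr_le z z Wpd; rewrite -/(qform _ _) => h.
    rewrite -(@ler_pM2r _ (qform 1%:M z)) ?q1// -expr2.
    apply: le_trans h _; rewrite mulrAC mulrC ler_wpM2r//; exact: psdmx_qform.
  have : mu + K^-1 <= mu.
    apply: lb_le_inf; first by exists (qform V x / qform 1%:M x).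
    move=> _ [z z0 ->]; have := low z z0; rewrite qW mulrBl mulfK ?lt0r_neq0 ?q1//; lra.
  by rewrite gerDl leNgt invr_gt0 K0.
have mu_eigen : eigenvalue V mu.
  by rewrite /eigenvalue /eigenspace kermx_eq0 row_free_unit.
apply: le_trans (muP x); rewrite ler_wpM2r ?qform1_ge0//.
apply: ge_inf => //; exists 0 => a /eigenvalueP[z zV z0].
have zt0 : z^T != 0 by rewrite trmx_eq0.
have : 0 <= qform V z^T := psdmx_qform _ Vp.
rewrite /qform /bform trmxK zV -scalemxAl mxE.
have := q1 _ zt0; rewrite /qform /bform trmxK mulmx1 => h.
by rewrite pmulr_lge0.
Qed.

End Determinants.

(** * The potential: dependence on the increment and on the variance *)

Section Potential.
Variable R : realType.
Implicit Types d : nat.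

(* Agrees with [invmx] on invertible matrices, but its entries are measurable
   functions of those of the matrix without a case distinction. *)
Definition cramer_inv d (A : 'M[R]_d) : 'M[R]_d := (\det A)^-1 *: \adj A.

Lemma cramer_invE d (A : 'M[R]_d) : A \in unitmx -> cramer_inv A = invmx A.
Proof. by move=> Au; rewrite /cramer_inv /invmx Au. Qed.

Definition regmx d (rho : R) (V : 'M[R]_d) : 'M[R]_d := 1%:M + rho^-1 *: V.

Definition scaled_norm d (rho : R) (V : 'M[R]_d) (m : 'cV[R]_d) : R :=
  Num.sqrt (qform (cramer_inv (regmx rho V)) m) / rho.

Definition potential d (rho : R) (V : 'M[R]_d) (m : 'cV[R]_d) : R :=
  expR (rho * bennett (scaled_norm rho V m)) / Num.sqrt (\det (regmx rho V)).

Definition slope d (rho : R) (V : 'M[R]_d) (m : 'cV[R]_d) : R :=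
  ln (1 + scaled_norm rho V m) / scaled_norm rho V m.

Definition dual d (rho : R) (V : 'M[R]_d) (m : 'cV[R]_d) : 'cV[R]_d :=
  cramer_inv (regmx rho V) *m m.

(** The majorant of [bennett_increment] expanded in the coordinates of the increment. Entrywise
    coefficients are scalars that can be pulled out of the conditional expectations of x_i and x_i
    x_j. *)
Definition lin_coef d (rho : R) (V : 'M[R]_d) (m : 'cV[R]_d) (i : 'I_d) : R :=
  potential rho V m * (slope rho V m * dual rho V m i ord0 / rho).

Definition quad_coef d (rho : R) (V : 'M[R]_d) (m : 'cV[R]_d) (i j : 'I_d) : R :=
  potential rho V m *
  ((cramer_inv (regmx rho V) i j / rho +
    slope rho V m * (dual rho V m i ord0 * dual rho V m j ord0) / rho ^+ 2) / 2).

Lemma potential_ge0 d rho (V : 'M[R]_d) m : 0 <= potential rho V m.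
Proof. by rewrite divr_ge0 ?expR_ge0 ?sqrtr_ge0. Qed.

Lemma pdmx_regmx d rho (V : 'M[R]_d) : 0 < rho -> psdmx V -> pdmx (regmx rho V).
Proof.
move=> r0 Vp; apply: pdmxD; first exact: pdmx1.
by apply: psdmxZ => //; rewrite invr_ge0 ltW.
Qed.

Lemma qform_regmx_ge d rho (V : 'M[R]_d) x : 0 < rho -> psdmx V ->
  qform 1%:M x <= qform (regmx rho V) x.
Proof.
move=> r0 Vp; rewrite /regmx /qform bformDm lerDl bformZm mulr_ge0//.
  by rewrite invr_ge0 ltW.
exact: psdmx_qform.
Qed.

Lemma potential_increment d rho (V : 'M[R]_d) m x : 0 < rho -> psdmx V -> enorm x <= 1 ->
  potential rho V (m + x) <= potential rho V m +
    \sum_i lin_coef rho V m i * x i ord0 +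
    \sum_i \sum_j quad_coef rho V m i j * (x i ord0 * x j ord0).
Proof.
move=> r0 Vp x1.
have Np := pdmx_regmx r0 Vp; have Nu := pdmx_unit Np.
set N := regmx rho V in Np Nu.
have Ip := pdmx_inv Np; have Ipsd := pdmx_psd Ip; have Is := Ip.1.
have r_neq0 : rho != 0 by rewrite lt0r_neq0.
set G := invmx N in Ip Ipsd Is.
have GE : cramer_inv (regmx rho V) = G by rewrite cramer_invE.
set b := slope rho V m.
pose k := bform G m x / rho.
pose s := qform G x / rho.
have sc z : scaled_norm rho V z = Num.sqrt (qform G z) / rho by rewrite /scaled_norm GE.
have q0 z : 0 <= qform G z by exact: psdmx_qform.
have sc2 z : scaled_norm rho V z ^+ 2 = qform G z / rho ^+ 2.
  by rewrite sc expr_div_n sqr_sqrtr.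
have lin : \sum_i lin_coef rho V m i * x i ord0 = potential rho V m * (b * k).
  have -> : k = \sum_i (dual rho V m i ord0 / rho) * x i ord0.
    rewrite /k (bform_sym _ _ Is) /bform -mulmxA mxE big_distrl; apply: eq_bigr => i _ /=.
    by rewrite /dual GE [x^T _ _]mxE; ring.
  rewrite !big_distrr; apply: eq_bigr => i _ /=; rewrite /lin_coef -/b; ring.
have quad : \sum_i \sum_j quad_coef rho V m i j * (x i ord0 * x j ord0) =
    potential rho V m * (s / 2 + b * k ^+ 2 / 2).
  have -> : k ^+ 2 = (\sum_i (dual rho V m i ord0 / rho) * x i ord0) *
                     (\sum_j (dual rho V m j ord0 / rho) * x j ord0).
    rewrite expr2; congr (_ * _); rewrite /k (bform_sym _ _ Is) /bform -mulmxA mxE big_distrl;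
    by apply: eq_bigr => i _ /=; rewrite /dual GE [x^T _ _]mxE; ring.
  rewrite /s /qform bform_sumE !big_distrl/= -mulrA big_distrl big_distrr -big_split big_distrr.
  apply: eq_bigr => i _ /=.
  rewrite !big_distrl big_distrr/= !big_distrl big_distrr/= -big_split big_distrr/=.
  apply: eq_bigr => j _ /=; rewrite /quad_coef -/b GE.
  by field.
rewrite lin quad.
have -> : potential rho V m + potential rho V m * (b * k) +
    potential rho V m * (s / 2 + b * k ^+ 2 / 2) =
  potential rho V m * (1 + b * k + s / 2 + b * k ^+ 2 / 2) by ring.
rewrite /potential mulrAC ler_pM2r; last by rewrite invr_gt0 sqrtr_gt0 pdmx_det_gt0.
(* N >= I gives N^-1 <= I, so the Euclidean bound on [x] carries over to the metric of N^-1. *)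
have qx1 : qform G x <= 1.
  have hN : forall z, qform 1%:M z <= qform N z by move=> z; exact: qform_regmx_ge.
  have := qform_invmx_antitone x (@pdmx1 R d) Np hN.
  rewrite invmx1 -/G => h; apply: le_trans h _.
  have := x1; rewrite enormE => h1.
  by rewrite -(sqr_sqrtr (qform1_ge0 x)) expr_le1// sqrtr_ge0.
rewrite -[X in expR (rho * X) <= _](addrNK (bennett (scaled_norm rho V m))) mulrDr expRD mulrC.
rewrite ler_pM2l ?expR_gt0//.
set dh := bennett _ - _.
have -> : rho * dh = dh / (2 * (2 * rho)^-1) by field.
apply: bennett_increment.
- by rewrite invr_gt0 mulr_gt0.
- by rewrite sc divr_ge0 ?sqrtr_ge0 ?(ltW r0).
- by rewrite sc divr_ge0 ?sqrtr_ge0 ?(ltW r0).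
- rewrite !sc2 /qform bformDl !bformDr (bform_sym x m Is) /k /s /qform.
  by field.
- by rewrite divr_ge0 ?(ltW r0).
- rewrite /s ler_pdivrMr//; have -> : 2 * (2 * rho)^-1 * rho = 1 by field.
  by [].
- rewrite sc2 /k /s.
  have -> : 2 * (2 * rho)^-1 * (bform G m x / rho) ^+ 2 = bform G m x ^+ 2 / rho ^+ 3 by field.
  have -> : qform G m / rho ^+ 2 * (qform G x / rho) = qform G m * qform G x / rho ^+ 3 by field.
  by rewrite ler_pM2r ?invr_gt0 ?exprn_gt0//; exact: psdmx_cauchy_schwarz.
Qed.

(** [z] and [z'] will be the lengths of m before and after the form grows, and [e] the added form at
    the new dual vector. The last hypothesis gives z^2 >= z'^4 / (z'^2 - e), which exceeds z'^2 + e
    + e^2 / (4 z'^2), the square of z' + e / (2 z'). *)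
Lemma sqr_gap (z z' e : R) : 0 <= z -> 0 < z' -> 0 <= e -> e <= z' ^+ 2 ->
  z' ^+ 4 <= (z' ^+ 2 - e) * z ^+ 2 -> e / (2 * z') <= z - z'.
Proof.
move=> z0 z'0 e0 ez hz.
have y0 : 0 < z' ^+ 2 by rewrite exprn_gt0.
have zz : (z' + e / (2 * z')) ^+ 2 <= z ^+ 2.
  have -> : (z' + e / (2 * z')) ^+ 2 = z' ^+ 2 + e + e ^+ 2 / (4 * z' ^+ 2).
    by field; rewrite lt0r_neq0.
  move: y0 ez hz; rewrite (_ : z' ^+ 4 = (z' ^+ 2) ^+ 2); last by ring.
  move: (z' ^+ 2) (z ^+ 2) => y q {z z' z0 z'0} y0 ey hz.
  rewrite -lerBrDl ler_pdivrMr ?mulr_gt0//.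
  have ht : e ^+ 2 <= (y - e) * (q - (y + e)) by lra.
  have ye : 0 < y - e.
    rewrite lt0r subr_ge0 ey andbT; apply: contraTN hz => /eqP ->.
    by rewrite mul0r -ltNge exprn_gt0.
  have t0 : 0 <= q - (y + e) by rewrite -(pmulr_rge0 _ ye) (le_trans (sqr_ge0 e)).
  by apply: le_trans ht _; rewrite mulrC ler_wpM2l//; lra.
have h : 0 <= z' + e / (2 * z') by rewrite addr_ge0 ?divr_ge0 ?mulr_ge0 ?(ltW z'0).
by move: zz; rewrite ler_sqr ?nnegrE//; lra.
Qed.

(** The quadratic part equals the potential times T / 2 + b e / (2 rho). After 1 + x <= exp x the
    two summands are treated separately: [hsq] absorbs the first in the determinant, [hben] the
    second in the Bennett exponent. *)
Lemma potential_compensator d rho (V C : 'M[R]_d) m : 0 < rho -> psdmx V -> psdmx C ->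
  potential rho (V + C) m + \sum_i \sum_j quad_coef rho (V + C) m i j * C i j <=
  potential rho V m.
Proof.
move=> r0 Vp Cp; have r_neq0 : rho != 0 by rewrite lt0r_neq0.
pose D := rho^-1 *: C.
have Dp : psdmx D by apply: psdmxZ => //; rewrite invr_ge0 ltW.
have Np := pdmx_regmx r0 Vp; have Nu := pdmx_unit Np.
have Np' := pdmx_regmx r0 (psdmxD Vp Cp); have Nu' := pdmx_unit Np'.
have N'E : regmx rho (V + C) = regmx rho V + D by rewrite /regmx scalerDr addrA.
set b := slope rho (V + C) m.
set th := dual rho (V + C) m.
have thE : th = invmx (regmx rho (V + C)) *m m by rewrite /th /dual cramer_invE.
have [hdet htr] := pdmx_det_ratio Np Dp; rewrite -N'E in hdet htr.
set T := \tr _ in hdet htr.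
pose e := qform D th.
have quad : \sum_i \sum_j quad_coef rho (V + C) m i j * C i j =
    potential rho (V + C) m * (T / 2 + b * e / (2 * rho)).
  have -> : T / 2 + b * e / (2 * rho) = T * 2^-1 + e * (b / (2 * rho)) by field.
  have -> : T = \sum_i \sum_j cramer_inv (regmx rho (V + C)) i j * (C i j / rho).
    rewrite /T /mxtrace; apply: eq_bigr => i _; rewrite mxE cramer_invE//.
    apply: eq_bigr => j _; congr (_ * _); rewrite /D mxE mulrC; congr (_ * _).
    by rewrite -[in RHS]Cp.1 mxE.
  have -> : e = \sum_i \sum_j C i j / rho * (th i ord0 * th j ord0).
    rewrite /e /qform bform_sumE; apply: eq_bigr => i _; apply: eq_bigr => j _.
    by rewrite mxE; ring.
  rewrite !big_distrl/= -big_split/= big_distrr/=; apply: eq_bigr => i _ /=.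
  rewrite !big_distrl/= -big_split/= big_distrr/=; apply: eq_bigr => j _ /=.
  by rewrite /quad_coef -/b -/th; field.
rewrite quad.
have -> : potential rho (V + C) m + potential rho (V + C) m * (T / 2 + b * e / (2 * rho)) =
  potential rho (V + C) m * (1 + (T / 2 + b * e / (2 * rho))) by ring.
pose z := Num.sqrt (qform (invmx (regmx rho V)) m).
pose z' := Num.sqrt (qform (invmx (regmx rho (V + C))) m).
have q0 : 0 <= qform (invmx (regmx rho V)) m.
  exact: (psdmx_qform _ (pdmx_psd (pdmx_inv Np))).
have q0' : 0 <= qform (invmx (regmx rho (V + C))) m.
  exact: (psdmx_qform _ (pdmx_psd (pdmx_inv Np'))).
have z0 : 0 <= z by exact: sqrtr_ge0.
have z0' : 0 <= z' by exact: sqrtr_ge0.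
have sE : scaled_norm rho V m = z / rho by rewrite /scaled_norm cramer_invE.
have sE' : scaled_norm rho (V + C) m = z' / rho by rewrite /scaled_norm cramer_invE.
have e0 : 0 <= e by exact: psdmx_qform.
have thN : qform (regmx rho (V + C)) th = z' ^+ 2.
  by rewrite thE qform_invmx ?sqr_sqrtr//; exact: Np'.1.
have thNe : qform (regmx rho V) th = z' ^+ 2 - e.
  by rewrite -thN N'E /qform bformDm addrK.
have thm : bform 1%:M th m = z' ^+ 2.
  by rewrite thE sqr_sqrtr// /qform /bform trmx_mul trmx_inv Np'.1 mulmx1.
have hz : z' ^+ 4 <= (z' ^+ 2 - e) * z ^+ 2.
  by rewrite -thNe sqr_sqrtr//; have := dot_sqr_le th m Np; rewrite thm -exprM.
(* The tangent of [bennett] at the new norm bounds its drop from below by a multiple of [z - z'];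
   [sqr_gap], fed with duality for [th] and [m], supplies e / (2 z'). At [z' = 0] the slope is 0 by
   convention. *)
have hben : b * e / (2 * rho) <= rho * (bennett (z / rho) - bennett (z' / rho)).
  have r1 : 0 <= rho^-1 by rewrite invr_ge0 ltW.
  have tang : ln (1 + z' / rho) * (z / rho - z' / rho) <= bennett (z / rho) - bennett (z' / rho).
    by apply: bennett_tangent; apply: (@lt_le_trans _ _ 0); rewrite ?mulr_ge0//; lra.
  apply: le_trans (ler_wpM2l (ltW r0) tang).
  rewrite /b /slope sE'.
  have [z'0|z'0] := eqVneq z' 0.
    rewrite z'0 !mul0r addr0 ln1 !mul0r mulr0//.
  have z'p : 0 < z' by rewrite lt0r z'0.
  have hzz : e / (2 * z') <= z - z'.
    apply: sqr_gap => //; rewrite -subr_ge0 -thNe.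
    exact: (psdmx_qform _ (pdmx_psd Np)).
  have l0 : 0 <= ln (1 + z' / rho).
    by rewrite ln_ge0// lerDl mulr_ge0.
  have -> : ln (1 + z' / rho) / (z' / rho) * e / (2 * rho) = ln (1 + z' / rho) * (e / (2 * z')).
    by field; rewrite r_neq0 z'0.
  have -> : rho * (ln (1 + z' / rho) * (z / rho - z' / rho)) = ln (1 + z' / rho) * (z - z').
    by field.
  exact: ler_wpM2l.
have d0 := pdmx_det_gt0 Np; have d0' := pdmx_det_gt0 Np'.
set dN := \det (regmx rho V) in hdet d0.
set dN' := \det (regmx rho (V + C)) in hdet d0'.
have hsq : expR (T / 2) / Num.sqrt dN' <= (Num.sqrt dN)^-1.
  rewrite ler_pdivrMr ?sqrtr_gt0// [leRHS]mulrC ler_pdivlMr ?sqrtr_gt0//.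
  have -> : expR (T / 2) = Num.sqrt (expR T).
    rewrite -[LHS]ger0_norm ?expR_ge0// -sqrtr_sqr expr2 -expRD.
    by congr (Num.sqrt (expR _)); field.
  rewrite -sqrtrM ?expR_ge0// ler_sqrt ?(ltW d0')//.
  by rewrite -(@ler_pM2r _ (expR (- T))) ?expR_gt0// mulrAC expRxMexpNx_1 mul1r.
rewrite /potential sE sE' -/dN -/dN'.
apply: (@le_trans _ _ (expR (rho * bennett (z' / rho)) *
   (expR (T / 2) / Num.sqrt dN' * expR (b * e / (2 * rho))))).
  have -> : expR (rho * bennett (z' / rho)) *
   (expR (T / 2) / Num.sqrt dN' * expR (b * e / (2 * rho))) =
   expR (rho * bennett (z' / rho)) / Num.sqrt dN' * expR (T / 2 + b * e / (2 * rho)).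
    by rewrite expRD; ring.
  by rewrite ler_pM2l ?expR_ge1Dx// divr_gt0 ?expR_gt0// sqrtr_gt0.
apply: (@le_trans _ _ (expR (rho * bennett (z' / rho)) *
   ((Num.sqrt dN)^-1 * expR (rho * (bennett (z / rho) - bennett (z' / rho)))))).
  rewrite ler_pM2l ?expR_gt0//; apply: ler_pM => //.
  by rewrite ler_expR.
have -> : rho * bennett (z / rho) =
  rho * bennett (z' / rho) + rho * (bennett (z / rho) - bennett (z' / rho)) by ring.
by rewrite expRD [leRHS]mulrC mulrCA.
Qed.

End Potential.

(** * Measurability of the potential and its coefficients *)

Section MeasurabilityOfPotential.
Context {disp : measure_display} {T : measurableType disp} {R : realType}.

Let mfun (f : T -> R) := measurable_fun [set: T] f.

(** The formula x^-1 = x exp (- ln (x^2)) also holds at 0, where the inverse is 0 by convention. *)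
Lemma measurable_invr (f : T -> R) : mfun f -> mfun (fun w => (f w)^-1).
Proof.
move=> mf.
have -> : (fun w => (f w)^-1) = (fun w => f w * expR (- ln (f w ^+ 2))).
  apply/funext => w; have [->|f0] := eqVneq (f w) 0; first by rewrite invr0 mul0r.
  rewrite expRN lnK ?posrE ?exprn_even_gt0// expr2 invfM mulrA divff// mul1r//.
apply: measurable_funM => //.
apply: (measurableT_comp (@measurable_expR R)).
apply: measurable_funN; apply: (measurableT_comp (@measurable_ln R)).
exact: measurable_funX.
Qed.

Lemma measurable_sqrtr (f : T -> R) : mfun f -> mfun (fun w => Num.sqrt (f w)).
Proof.
move=> mf; apply: (measurableT_comp _ mf).
by apply: continuous_measurable_fun; exact: sqrt_continuous.
Qed.

Lemma measurable_det n (A : T -> 'M[R]_n) :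
  (forall i j, mfun (fun w => A w i j)) -> mfun (fun w => \det (A w)).
Proof.
move=> mA; rewrite /mfun /determinant; apply: measurable_sum => s.
by apply: measurable_funM => //; apply: measurable_prod => i _; exact: mA.
Qed.

Lemma measurable_cramer_inv n (A : T -> 'M[R]_n) :
  (forall i j, mfun (fun w => A w i j)) ->
  forall i j, mfun (fun w => cramer_inv (A w) i j).
Proof.
move=> mA i j; rewrite /mfun.
have -> : (fun w => cramer_inv (A w) i j) =
  (fun w => (\det (A w))^-1 * ((-1) ^+ (j + i) * \det (row' j (col' i (A w))))).
  by apply/funext => w; rewrite /cramer_inv !mxE.
apply: measurable_funM; first by apply: measurable_invr; exact: measurable_det.
apply: measurable_funM => //; apply: measurable_det => k l.
have -> : (fun w => row' j (col' i (A w)) k l) = (fun w => A w (lift j k) (lift i l)).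
  by apply/funext => w; rewrite !mxE.
exact: mA.
Qed.

Section potential.
Variables (d : nat) (rho : T -> R) (V : T -> 'M[R]_d) (m : T -> 'cV[R]_d).
Hypothesis mrho : mfun rho.
Hypothesis mV : forall i j, mfun (fun w => V w i j).
Hypothesis mm : forall i, mfun (fun w => m w i ord0).

Let mN i j : mfun (fun w => regmx (rho w) (V w) i j).
Proof.
have -> : (fun w => regmx (rho w) (V w) i j) = (fun w => (1%:M : 'M[R]_d) i j + (rho w)^-1 * V w i j).
  by apply/funext => w; rewrite /regmx !mxE.
apply: measurable_funD; first exact: measurable_cst.
by apply: measurable_funM; [exact: measurable_invr|exact: mV].
Qed.

Let mI i j : mfun (fun w => cramer_inv (regmx (rho w) (V w)) i j).
Proof. by apply: measurable_cramer_inv => k l; exact: mN. Qed.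

Lemma measurable_scaled_norm : mfun (fun w => scaled_norm (rho w) (V w) (m w)).
Proof.
apply: measurable_funM; last exact: measurable_invr.
apply: measurable_sqrtr; rewrite /mfun /qform; under eq_fun do rewrite bform_sumE.
apply: measurable_sum => i; apply: measurable_sum => j.
by apply: measurable_funM; [exact: mI|apply: measurable_funM; exact: mm].
Qed.

(** [rho] varies with the point so that joint measurability in [rho] and the outcome is an instance,
    as Tonelli's theorem requires. *)
Lemma measurable_potential : mfun (fun w => potential (rho w) (V w) (m w)).
Proof.
apply: measurable_funM; last first.
  by apply: measurable_invr; apply: measurable_sqrtr; apply: measurable_det => i j; exact: mN.
apply: (measurableT_comp (@measurable_expR R)); apply: measurable_funM => //.
have ms := measurable_scaled_norm.
apply: measurable_funB => //; apply: measurable_funM; first exact: measurable_funD.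
by apply: (measurableT_comp (@measurable_ln R)); exact: measurable_funD.
Qed.

Let mslope : mfun (fun w => slope (rho w) (V w) (m w)).
Proof.
have ms := measurable_scaled_norm.
apply: measurable_funM; last exact: measurable_invr.
by apply: (measurableT_comp (@measurable_ln R)); exact: measurable_funD.
Qed.

Let mdual i : mfun (fun w => dual (rho w) (V w) (m w) i ord0).
Proof.
rewrite /mfun /dual; under eq_fun do rewrite mxE.
by apply: measurable_sum => j; apply: measurable_funM; [exact: mI|exact: mm].
Qed.

Lemma measurable_lin_coef i : mfun (fun w => lin_coef (rho w) (V w) (m w) i).
Proof.
apply: measurable_funM; first exact: measurable_potential.
apply: measurable_funM; last exact: measurable_invr.
by apply: measurable_funM; [exact: mslope|exact: mdual].
Qed.

Lemma measurable_quad_coef i j : mfun (fun w => quad_coef (rho w) (V w) (m w) i j).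
Proof.
apply: measurable_funM; first exact: measurable_potential.
apply: measurable_funM => //; apply: measurable_funD.
  by apply: measurable_funM; [exact: mI|exact: measurable_invr].
apply: measurable_funM; last by apply: measurable_invr; exact: measurable_funX.
apply: measurable_funM; first exact: mslope.
by apply: measurable_funM; exact: mdual.
Qed.

End potential.
End MeasurabilityOfPotential.

(** * Conditional expectation: pulling out bounded factors *)

Section PullOut.
Context {disp : measure_display} {T : measurableType disp} {R : realType}.
Variables (P : probability T R) (G : set (set T)).
Hypothesis hG : sigma_algebra [set: T] G.
Hypothesis Gm : G `<=` measurable.

Lemma measurable_sub_sigma : (measurable : set (set (g_sigma_algebraType G))) = G.
Proof. exact: sigma_algebra_id. Qed.

Lemma measurable_wrtP (Y : T -> R) : measurable_wrt G Y <->
  measurable_fun [set: g_sigma_algebraType G] (Y : g_sigma_algebraType G -> R).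
Proof.
split=> [h _ B mB|h B mB]; first by rewrite setTI measurable_sub_sigma; exact: h.
by have := h measurableT B mB; rewrite setTI measurable_sub_sigma.
Qed.

Lemma measurable_sub_fun d' (U : measurableType d') (Y : T -> U) :
  measurable_fun [set: g_sigma_algebraType G] (Y : g_sigma_algebraType G -> U) ->
  measurable_fun [set: T] Y.
Proof.
move=> h _ B mB; rewrite setTI; apply: Gm; rewrite -measurable_sub_sigma.
by have := h measurableT B mB; rewrite setTI.
Qed.

Lemma measurable_wrt_fun (Y : T -> R) : measurable_wrt G Y -> measurable_fun [set: T] Y.
Proof. by move/measurable_wrtP; exact: measurable_sub_fun. Qed.

(** The sum of indicators is the integer part of [x] capped at [N]; the first clause, saturation,
    drives the induction. *)
Lemma layer_cake_approx (N : nat) (x : R) : 0 <= x ->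
  [/\ N%:R <= x -> \sum_(j < N) (j.+1%:R <= x)%R%:R = N%:R :> R,
      \sum_(j < N) (j.+1%:R <= x)%R%:R <= x &
      x <= N%:R -> x - 1 <= \sum_(j < N) (j.+1%:R <= x)%R%:R].
Proof.
move=> x0; elim: N => [|N [IH1 IH2 IH3]].
  by rewrite big_ord0; split => // ?; lra.
rewrite big_ord_recr/=; have N1 : N.+1%:R = N%:R + 1 :> R by rewrite -natr1.
have [h|h] := leP N.+1%:R x.
  have hN : N%:R <= x by lra.
  by rewrite IH1//=; split=> *; lra.
rewrite addr0; split=> [?|//|_]; first by lra.
have [hN|hN] := leP x N%:R; first exact: IH3.
by rewrite IH1; lra.
Qed.


(** The level sets of [xi] lie in [G], so each layer contributes 0; n + 1 layers per unit
    approximate [xi] uniformly within 1 / (n + 1), which gives [step]. *)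
Lemma integral_mul_eq0_pos (xi W : T -> R) (K : nat) : measurable_wrt G xi ->
  (forall w, 0 <= xi w <= K%:R) -> P.-integrable [set: T] (EFin \o W) ->
  (forall A, G A -> (\int[P]_(w in A) (W w)%:E = 0)%E) ->
  (\int[P]_w (xi w * W w)%:E = 0)%E.
Proof.
move=> mxi xiK iW W0.
have mxi' := measurable_wrt_fun mxi.
have ixiW : P.-integrable [set: T] (fun w => (xi w * W w)%:E).
  have := @integrableMr _ _ _ P setT measurableT xi (EFin \o W) mxi' _ iW.
  apply; exists K%:R; split => // x Kx w _ /=.
  have /andP[h1 h2] := xiK w.
  by rewrite ger0_norm// (le_trans h2)// ltW.
have iaW := integrable_abse iW.
have fin := integrable_fin_num measurableT ixiW.
have fina := integrable_fin_num measurableT iaW.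
pose c := fine (\int[P]_w (abse \o (EFin \o W)) w)%E.
have step n : `|fine (\int[P]_w (xi w * W w)%:E)%E| <= n.+1%:R^-1 * c.
  pose B (j : nat) := [set w | j.+1%:R <= n.+1%:R * xi w].
  have GB j : G (B j).
    have := mxi `[j.+1%:R / n.+1%:R, +oo[%classic (measurable_itv _).
    congr G; apply/seteqP; split => w /=; rewrite in_itv/= andbT.
      by rewrite ler_pdivrMr// mulrC.
    by rewrite /B/= ler_pdivrMr// mulrC.
  have mB j : measurable (B j) by exact: Gm.
  pose h (j : 'I_(K * n.+1)) := (EFin \o W) \_ (B j).
  have ih j : P.-integrable [set: T] (h j).
    by apply: (integrable_mkcond _ (mB j)).1; exact: (integrableS measurableT (mB j) (@subsetT _ _) iW).
  have inth j : (\int[P]_w h j w = 0)%E by rewrite -integral_mkcond W0.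
  have iS : P.-integrable [set: T] (fun w => \sum_(j < K * n.+1) h j w)%E.
    by apply: integrable_sum.
  have intS : (\int[P]_w (\sum_(j < K * n.+1) h j w) = 0)%E.
    by rewrite integral_sum//; under eq_bigr do rewrite inth; rewrite big1.
  have SE w : (\sum_(j < K * n.+1) h j w)%E =
      ((\sum_(j < K * n.+1) (j.+1%:R <= n.+1%:R * xi w)%R%:R) * W w)%:E.
    rewrite big_distrl/= -sumEFin; apply: eq_bigr => j _.
    rewrite /h patchE; case: ifPn; rewrite ?inE ?notin_setE /B /= => hB.
      by rewrite hB mul1r.
    by move/negP: hB => /negbTE ->; rewrite mul0r.
  have key : (`|\int[P]_w (n.+1%:R%:E * (xi w * W w)%:E)| <=
              \int[P]_w (abse \o (EFin \o W)) w)%E.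
    have -> : (\int[P]_w (n.+1%:R%:E * (xi w * W w)%:E) =
              \int[P]_w (n.+1%:R%:E * (xi w * W w)%:E - \sum_(j < K * n.+1) h j w))%E.
      by rewrite integralB ?intS ?sube0//; exact: integrableZl.
    apply: le_trans (le_abse_integral _ _ _) _ => //.
      apply: (measurable_int P); apply: integrableB => //; exact: integrableZl.
    apply: ge0_le_integral => //.
    - apply: measurableT_comp => //.
      apply: (measurable_int P); apply: integrableB => //; exact: integrableZl.
    - exact: (measurable_int P).
    move=> w _; rewrite SE -EFinM -EFinB /= lee_fin mulrA -mulrBl normrM.
    rewrite ler_piMl//.
    have /andP[x0 xK] := xiK w.
    have nx0 : 0 <= n.+1%:R * xi w by rewrite mulr_ge0.
    have [_ c1 c2] := layer_cake_approx (K * n.+1) nx0.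
    rewrite ger0_norm ?subr_ge0//.
    have : n.+1%:R * xi w <= (K * n.+1)%:R by rewrite natrM mulrC ler_wpM2r.
    by move/c2; lra.
  move: key; rewrite integralZl// -(fineK fin) -(fineK fina) -EFinM/= lee_fin -/c.
  by rewrite normrM ger0_norm// ler_pdivlMl.
rewrite -(fineK fin); congr EFin; apply/eqP; rewrite -normr_eq0.
rewrite eq_le normr_ge0 andbT; apply/ler_addgt0Pl => e e0; rewrite addr0.
have c0 : 0 <= c by apply: fine_ge0; apply: integral_ge0 => w _; exact: abse_ge0.
have [N hN] : exists N : nat, c / e <= N.+1%:R.
  exists (Num.truncn (c / e)); apply: ltW; exact: truncnS_gt.
apply: le_trans (step N) _; rewrite ler_pdivrMl// mulrC.
by rewrite -ler_pdivrMl// mulrC.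
Qed.

Lemma integral_mul_eq0 (xi W : T -> R) (K : R) : measurable_wrt G xi ->
  (forall w, `|xi w| <= K) -> P.-integrable [set: T] (EFin \o W) ->
  (forall A, G A -> (\int[P]_(w in A) (W w)%:E = 0)%E) ->
  P.-integrable [set: T] (fun w => (xi w * W w)%:E) /\ (\int[P]_w (xi w * W w)%:E = 0)%E.
Proof.
move=> mxi xiK iW W0.
pose xi' w := xi w + K.
pose N := (Num.truncn (2 * K)).+1.
have mxi' : measurable_wrt G xi'.
  by move/measurable_wrtP: mxi => mxi; apply/measurable_wrtP; exact: measurable_funD.
have xi'N w : 0 <= xi' w <= N%:R.
  have h : 2 * K < N%:R by exact: truncnS_gt.
  by have := xiK w; rewrite ler_norml /xi' => /andP[h1 h2]; apply/andP; split; lra.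
have ib : P.-integrable [set: T] (fun w => (xi' w * W w)%:E).
  have := @integrableMr _ _ _ P setT measurableT xi' (EFin \o W) (measurable_wrt_fun mxi') _ iW.
  apply; exists N%:R; split => // x Kx w _ /=.
  have /andP[h1 h2] := xi'N w.
  by rewrite ger0_norm// (le_trans h2)// ltW.
have h1 := integral_mul_eq0_pos mxi' xi'N iW W0.
have iK : P.-integrable [set: T] (fun w => K%:E * (EFin \o W) w)%E by exact: integrableZl.
have intW : (\int[P]_w (W w)%:E = 0)%E by apply: W0; case: hG => G0 GC _; have := GC _ G0; rewrite setD0.
have xE : (fun w => (xi w * W w)%:E) = (fun w => (xi' w * W w)%:E - K%:E * (EFin \o W) w)%E.
  by apply/funext => w; congr EFin; rewrite /xi'/=; ring.
rewrite xE; split; first exact: integrableB.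
rewrite integralB//; rewrite [X in (X - _)%E]h1 sub0e integralZl//.
by rewrite [X in (_ * X)%E]intW mule0 oppe0.
Qed.

Lemma ae_ge0_of_integral (W : T -> R) : measurable_wrt G W ->
  P.-integrable [set: T] (EFin \o W) ->
  (forall A, G A -> (0 <= \int[P]_(w in A) (W w)%:E)%E) ->
  {ae P, forall w, 0 <= W w}.
Proof.
move=> mW iW W0; pose B := [set w | W w < 0].
have GB : G B.
  have -> : B = W @^-1` `]-oo, 0[%classic.
    by apply/seteqP; split => w; rewrite /B/= in_itv.
  exact: (mW _ (measurable_itv _)).
have mB := Gm GB.
have iB : P.-integrable B (EFin \o W) by exact: (integrableS measurableT mB (@subsetT _ _) iW).
have abs0 : (\int[P]_(w in B) `|(EFin \o W) w| = 0)%E.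
  apply/eqP; rewrite eq_le; apply/andP; split; last by apply: integral_ge0 => w _; exact: abse_ge0.
  have -> : (\int[P]_(w in B) `|(EFin \o W) w| = - \int[P]_(w in B) (W w)%:E)%E.
    rewrite -integralN; last exact: integrable_add_def.
    apply: eq_integral => w; rewrite inE /B /= => Ww.
    by rewrite ltr0_norm.
  by rewrite oppe_le0; exact: W0.
have /(ae_eq_integral_abs P mB) : measurable_fun B (EFin \o W) by exact: measurable_int iB.
move=> [/(_ abs0) + _]; apply: filterS => w /= h.
rewrite leNgt; apply/negP => Ww; have [] := h Ww => W_eq0.
by rewrite W_eq0 ltxx in Ww.
Qed.

Lemma cond_exp_version_sum (I : finType) (a : I -> R) (X Y : I -> T -> R) :
  (forall k, cond_exp_version P G (X k) (Y k)) ->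
  cond_exp_version P G (fun w => \sum_k a k * X k w) (fun w => \sum_k a k * Y k w).
Proof.
move=> h.
have iX k : P.-integrable [set: T] (EFin \o X k) by case: (h k).
have iY k : P.-integrable [set: T] (EFin \o Y k) by case: (h k).
have sE (Z : I -> T -> R) : (EFin \o (fun w => \sum_k a k * Z k w)) =
    (fun w => \sum_k (a k)%:E * (EFin \o Z k) w)%E.
  by apply/funext => w /=; rewrite -sumEFin; apply: eq_bigr => k _; rewrite EFinM.
have iZ (Z : I -> T -> R) D k : measurable D -> P.-integrable [set: T] (EFin \o Z k) ->
    P.-integrable D (EFin \o Z k).
  by move=> mD iZ; exact: (integrableS measurableT mD (@subsetT _ _) iZ).
split.
- by rewrite sE; apply: integrable_sum => // k _; exact: integrableZl.
- apply/measurable_wrtP; apply: measurable_sum => k; apply: measurable_funM => //.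
  by apply/measurable_wrtP; case: (h k).
- by rewrite sE; apply: integrable_sum => // k _; exact: integrableZl.
move=> A GA; have mA := Gm GA.
rewrite -[LHS]/(\int[P]_(w in A) (EFin \o (fun w => (\sum_k a k * Y k w)%R)) w)%E.
rewrite -[RHS]/(\int[P]_(w in A) (EFin \o (fun w => (\sum_k a k * X k w)%R)) w)%E !sE.
rewrite !integral_sum//; last 2 first.
- by move=> k; apply: integrableZl => //; exact: iZ.
- by move=> k; apply: integrableZl => //; exact: iZ.
apply: eq_bigr => k _; rewrite !integralZl//; [|exact: iZ|exact: iZ].
by congr (_ * _)%E; case: (h k) => _ _ _; exact.
Qed.

Lemma cond_exp_version_pull_out (X Y xi : T -> R) (K : R) : cond_exp_version P G X Y ->
  measurable_wrt G xi -> (forall w, `|xi w| <= K) ->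
  P.-integrable [set: T] (fun w => (xi w * (X w - Y w))%:E) /\
  (\int[P]_w (xi w * (X w - Y w))%:E = 0)%E.
Proof.
move=> [iX mY iY XY] mxi xiK.
have E : EFin \o (fun w => X w - Y w) = (fun w => (EFin \o X) w - (EFin \o Y) w)%E by [].
apply: (integral_mul_eq0 mxi xiK).
  by rewrite E; exact: integrableB.
move=> A GA; have mA := Gm GA.
rewrite -[LHS]/(\int[P]_(w in A) (EFin \o (fun w => (X w - Y w)%R)) w)%E E integralB//.
- rewrite [X in (_ - X)%E](_ : _ = \int[P]_(w in A) (X w)%:E)%E; last exact: XY.
  rewrite subee//; apply: integrable_fin_num => //.
  exact: (integrableS measurableT mA (@subsetT _ _) iX).
- exact: (integrableS measurableT mA (@subsetT _ _) iX).
- exact: (integrableS measurableT mA (@subsetT _ _) iY).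
Qed.

End PullOut.

(** * Comparison of integrals under almost sure inequalities *)

Section AlmostEverywhere.
Context {disp : measure_display} {T : measurableType disp} {R : realType}.
Variable P : probability T R.

Lemma ae_forall_countable (I : countType) (Q : I -> T -> Prop) :
  (forall i, {ae P, forall w, Q i w}) -> {ae P, forall w, forall i, Q i w}.
Proof.
move=> h.
have : {ae P, forall w, forall n, (fun n w => if unpickle n is Some i then Q i w else True) n w}.
  by apply: ae_foralln => n; case: (unpickle n) => [i|]; [exact: h|exact: aeW].
by apply: filterS => w /= hw i; have := hw (pickle i); rewrite pickleK.
Qed.

(** Together with the next lemma, this links the potentials, which are nonnegative but perhaps not
    integrable, with the truncated majorants, which are integrable but have a sign only almost
    surely. *)
Lemma ae_ge0_le_integrable (f g : T -> \bar R) : measurable_fun [set: T] f ->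
  (forall w, 0 <= f w)%E -> P.-integrable [set: T] g ->
  {ae P, forall w, f w <= g w}%E -> (\int[P]_w f w <= \int[P]_w g w)%E.
Proof.
move=> mf f0 ig fg; have mg := measurable_int _ ig.
have -> : (\int[P]_w g w = \int[P]_w (g^\+)%E w)%E.
  apply: ae_eq_integral => //; first exact: measurable_funepos.
  apply: filterS fg => w /= fg _; rewrite funeposE; apply/esym/max_idPl; exact: le_trans (f0 w) fg.
apply: ae_ge0_le_integral => //; first exact: measurable_funepos.
by apply: filterS fg => w /= fg _; rewrite funeposE le_max fg.
Qed.

Lemma ae_integrable_le_ge0 (f g : T -> \bar R) : P.-integrable [set: T] f ->
  measurable_fun [set: T] g -> (forall w, 0 <= g w)%E ->
  {ae P, forall w, f w <= g w}%E -> (\int[P]_w f w <= \int[P]_w g w)%E.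
Proof.
move=> iF mg g0 fg; have mf := measurable_int _ iF.
apply: (@le_trans _ _ (\int[P]_w (f^\+)%E w)%E).
  rewrite [leLHS]integralE leeBlDr ?leeDl ?integral_ge0//.
  exact: integrable_neg_fin_num.
apply: ae_ge0_le_integral => //; first exact: measurable_funepos.
by apply: filterS fg => w /= fg _; rewrite funeposE ge_max fg g0.
Qed.

End AlmostEverywhere.

(** * Almost sure positivity of the conditional covariance *)

Section ConditionalCovariance.
Context {disp : measure_display} {T : measurableType disp} {R : realType}.
Variables (P : probability T R) (G : set (set T)).
Hypothesis hG : sigma_algebra [set: T] G.
Hypothesis Gm : G `<=` measurable.

(** Each test vector costs a null set, so positivity is available almost surely only for countably
    many vectors at once. *)
Lemma qform_rat_dense d (A : 'M[R]_d) :
  (forall q : 'cV[rat]_d, 0 <= qform A (map_mx ratr q)) -> forall x, 0 <= qform A x.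
Proof.
move=> hq x; rewrite leNgt; apply/negP => x0.
pose B := \sum_i `|x i ord0|.
have xB i : `|x i ord0| <= B by rewrite /B (bigD1 i)//= lerDl sumr_ge0.
have B0 : 0 <= B by rewrite sumr_ge0.
(* Moving each coordinate by at most e <= 1 changes a product of two of them by at most e (2 B + 1),
   hence the form by at most e K. *)
pose K := (\sum_i \sum_j `|A i j|) * (2 * B + 1) + 1.
have K0 : 0 < K.
  by rewrite ltr_wpDl// mulr_ge0//; [apply: sumr_ge0 => i _; exact: sumr_ge0|lra].
pose eta := - qform A x.
have eta0 : 0 < eta by rewrite oppr_gt0.
pose e := Num.min 1 (eta / (2 * K)).
have e0 : 0 < e by rewrite lt_min ltr01 divr_gt0// mulr_gt0.
have e1 : e <= 1 by rewrite ge_min lexx.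
have eK : e * K <= eta / 2.
  apply: (@le_trans _ _ (eta / (2 * K) * K)); first by rewrite ler_pM2r// ge_min lexx orbT.
  by rewrite le_eqVlt; apply/orP; left; apply/eqP; field; rewrite lt0r_neq0.
have ex i : exists q : rat, `|ratr q - x i ord0| <= e.
  have /rat_in_itvoo[q] : x i ord0 - e < x i ord0 + e by lra.
  rewrite inE/= => /itvP h; exists q.
  have h1 : x i ord0 - e < ratr q by rewrite h.
  have h2 : ratr q < x i ord0 + e by rewrite h.
  by rewrite ler_norml; apply/andP; split; lra.
have [q qP] := choice ex.
have := hq (\col_i q i).
set z := map_mx _ _ => hz.
have zx i : `|z i ord0 - x i ord0| <= e by rewrite /z !mxE.
have : qform A z <= qform A x + e * K.
  rewrite -lerBlDl /qform !bform_sumE -sumrB.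
  have -> : e * K = e + \sum_i \sum_j `|A i j| * (e * (2 * B + 1)).
    rewrite /K mulrDr mulr1 addrC; congr (_ + _).
    rewrite mulrCA big_distrl/=; apply: eq_bigr => i _.
    by rewrite big_distrl.
  apply: (@le_trans _ _ (\sum_i \sum_j `|A i j| * (e * (2 * B + 1)))); last first.
    by rewrite lerDr ltW.
  apply: ler_sum => i _; rewrite -sumrB; apply: ler_sum => j _.
  rewrite -mulrBr; apply: le_trans (ler_norm _) _; rewrite normrM ler_wpM2l//.
  have -> : z i ord0 * z j ord0 - x i ord0 * x j ord0 =
    (z i ord0 - x i ord0) * (z j ord0 - x j ord0) +
    (z i ord0 - x i ord0) * x j ord0 + x i ord0 * (z j ord0 - x j ord0) by ring.
  apply: le_trans (ler_normD _ _) _; apply: (@le_trans _ _ (e * 1 + e * B + B * e)).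
    apply: lerD; last by rewrite normrM ler_pM.
    apply: le_trans (ler_normD _ _) _; apply: lerD; rewrite normrM ler_pM//.
    exact: le_trans (zx j) e1.
  lra.
rewrite -/eta; have : qform A x = - eta by rewrite opprK.
lra.
Qed.

Lemma cond_exp_version_ge0 (X Y : T -> R) : cond_exp_version P G X Y ->
  (forall w, 0 <= X w) -> {ae P, forall w, 0 <= Y w}.
Proof.
move=> [iX mY iY XY] X0; apply: (ae_ge0_of_integral Gm) => // A GA.
by rewrite XY//; apply: integral_ge0 => w _; rewrite lee_fin.
Qed.

Lemma cond_exp_version_eq (X Y Y' : T -> R) : cond_exp_version P G X Y ->
  cond_exp_version P G X Y' -> {ae P, forall w, Y w = Y' w}.
Proof.
have ge0 (Z Z' : T -> R) : cond_exp_version P G X Z ->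
    cond_exp_version P G X Z' -> {ae P, forall w, 0 <= Z w - Z' w}.
  move=> [_ mZ iZ XZ] [_ mZ' iZ' XZ']; apply: (ae_ge0_of_integral Gm).
  - by apply/(measurable_wrtP hG); apply: measurable_funB; exact/(measurable_wrtP hG).
  - have -> : EFin \o (fun w => Z w - Z' w) = (fun w => (EFin \o Z) w - (EFin \o Z') w)%E by [].
    exact: integrableB.
  move=> A GA; have mA := Gm GA.
  have iA f : P.-integrable [set: T] f -> P.-integrable A f.
    by move=> i; exact: (integrableS measurableT mA (@subsetT _ _) i).
  have -> : (\int[P]_(w in A) (Z w - Z' w)%:E = 
     \int[P]_(w in A) ((EFin \o Z) w - (EFin \o Z') w))%E by [].
  rewrite integralB//; [|exact: iA|exact: iA].
  rewrite [X in (_ - X)%E](_ : _ = \int[P]_(w in A) (EFin \o Z) w)%E; last first.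
    by rewrite [LHS]XZ' ?[RHS]XZ.
  by rewrite subee//; apply: integrable_fin_num => //; exact: iA.
move=> h h'; have h1 := ge0 _ _ h h'; have h2 := ge0 _ _ h' h.
by apply: filterS2 h1 h2 => w /=; rewrite !subr_ge0 => ? ?; apply/eqP; rewrite eq_le; apply/andP.
Qed.

(** For a fixed vector q, q^T C q is a version of the conditional expectation of (q^T X)^2. Symmetry
    is almost sure too: the entries (i, j) and (j, i) are versions for the same variable. *)
Lemma ae_psdmx d (X : T -> 'cV[R]_d) (C : T -> 'M[R]_d) :
  cond_exp_version_mx P G (fun w => X w *m (X w)^T) C -> {ae P, forall w, psdmx (C w)}.
Proof.
move=> h.
have XE w i j : (X w *m (X w)^T) i j = X w i ord0 * X w j ord0.
  by rewrite mxE big_ord1 mxE.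
have sym : {ae P, forall w, forall p : 'I_d * 'I_d, C w p.1 p.2 = C w p.2 p.1}.
  apply: ae_forall_countable => -[i j] /=.
  apply: (cond_exp_version_eq (h i j)).
  have -> : (fun w => (X w *m (X w)^T) i j) = (fun w => (X w *m (X w)^T) j i).
    by apply/funext => w; rewrite !XE mulrC.
  exact: h.
have pos : {ae P, forall w, forall q : 'cV[rat]_d, 0 <= qform (C w) (map_mx ratr q)}.
  apply: ae_forall_countable => q.
  pose x : 'cV[R]_d := map_mx ratr q.
  have := @cond_exp_version_sum _ _ _ P G hG Gm ('I_d * 'I_d)%type
    (fun p => x p.1 ord0 * x p.2 ord0) _ _ (fun p => h p.1 p.2).
  move=> /cond_exp_version_ge0 hh.
  have qE (A : 'M[R]_d) : qform A x =
      \sum_(p : 'I_d * 'I_d) x p.1 ord0 * x p.2 ord0 * A p.1 p.2.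
    rewrite /qform bform_sumE pair_bigA/=; apply: eq_bigr => p _; exact: mulrC.
  suff pw w : 0 <= \sum_(p : 'I_d * 'I_d) x p.1 ord0 * x p.2 ord0 * (X w *m (X w)^T) p.1 p.2.
    by apply: filterS (hh pw) => w /=; rewrite -qE.
  rewrite -qE /qform /bform mulmxA -mulmxA.
  have -> : (X w)^T *m x = (x^T *m X w)^T by rewrite trmx_mul trmxK.
  by rewrite mxE big_ord1 [X in _ * X]mxE -expr2 sqr_ge0.
apply: filterS2 sym pos => w /= hs hp; split; last exact: qform_rat_dense.
by apply/matrixP => i j; rewrite mxE; exact: (hs (j, i)).
Qed.

End ConditionalCovariance.

(** * The one-step supermartingale inequality *)

Section OneStep.
Context {disp : measure_display} {T : measurableType disp} {R : realType}.
Variables (P : probability T R) (G : set (set T)).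
Hypothesis hG : sigma_algebra [set: T] G.
Hypothesis Gm : G `<=` measurable.
Variables (d : nat) (M X : T -> 'cV[R]_d) (V C : T -> 'M[R]_d).
Hypothesis mM : forall i, measurable_wrt G (fun w => M w i ord0).
Hypothesis mV : forall i j, measurable_wrt G (fun w => V w i j).
Hypothesis hX : cond_exp_version_mx P G X (fun=> 0).
Hypothesis hC : cond_exp_version_mx P G (fun w => X w *m (X w)^T) C.
Hypothesis X1 : {ae P, forall w, enorm (X w) <= 1}.
Hypothesis Vpsd : {ae P, forall w, psdmx (V w)}.

(** Since [C] is [G]-measurable, the majorant can be expanded at [V + C] with [G]-measurable
    coefficients. Truncation to [AK k] makes them bounded, and monotone convergence removes the
    truncation. *)
Lemma potential_supermartingale rho A : 0 < rho -> G A ->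
  (\int[P]_(w in A) (potential rho (V w + C w) (M w + X w))%:E <=
   \int[P]_(w in A) (potential rho (V w) (M w))%:E)%E.
Proof.
move=> r0 GA; have mA := Gm GA.
have Cpsd := ae_psdmx hG Gm hC.
have XE w i j : (X w *m (X w)^T) i j = X w i ord0 * X w j ord0.
  by rewrite mxE big_ord1 mxE.
pose V' w := V w + C w.
have mC i j : measurable_wrt G (fun w => C w i j) by case: (hC i j).
have mV' i j : measurable_wrt G (fun w => V' w i j).
  apply/(measurable_wrtP hG).
  have -> : (fun w => V' w i j) = (fun w => V w i j + C w i j).
    by apply/funext => w; rewrite /V' mxE.
  by apply: measurable_funD; exact/(measurable_wrtP hG).
pose p0 w := potential rho (V' w) (M w).
pose lin i w := lin_coef rho (V' w) (M w) i.
pose quad i j w := quad_coef rho (V' w) (M w) i j.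
have gV' i j := (measurable_wrtP hG _).1 (mV' i j).
have gM i := (measurable_wrtP hG _).1 (mM i).
have gr : measurable_fun [set: g_sigma_algebraType G] (fun=> rho).
  exact: measurable_cst.
have gp0 : measurable_fun [set: g_sigma_algebraType G] p0.
  exact: (measurable_potential gr gV' gM).
have glin i : measurable_fun [set: g_sigma_algebraType G] (lin i).
  exact: (measurable_lin_coef gr gV' gM).
have gquad i j : measurable_fun [set: g_sigma_algebraType G] (quad i j).
  exact: (measurable_quad_coef gr gV' gM).
pose S w := p0 w + \sum_i `|lin i w| + \sum_(p : 'I_d * 'I_d) `|quad p.1 p.2 w|.
have gS : measurable_fun [set: g_sigma_algebraType G] S.
  apply: measurable_funD; first apply: measurable_funD => //.
    by apply: measurable_sum => i; exact: measurableT_comp.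
  by apply: measurable_sum => i; exact: measurableT_comp.
pose AK (k : nat) := A `&` [set w | S w <= k%:R].
have GAK k : G (AK k).
  rewrite -(measurable_sub_sigma hG); apply: measurableI.
    by rewrite measurable_sub_sigma.
  rewrite (_ : [set w | _] = [set: g_sigma_algebraType G] `&` S @^-1` `]-oo, k%:R]%classic).
    by apply: gS => //; exact: measurable_itv.
  by apply/seteqP; split => w /=; rewrite in_itv//= => -[].
have mAK k : measurable (AK k) by exact: Gm.
(* On [AK k] all the coefficients are bounded by [k], so that they can be
   pulled out of the conditional expectations. *)
have AKnd : nondecreasing_seq AK.
  move=> k l kl; apply/subsetPset => w [Aw Sw]; split => //.
  by apply: le_trans Sw _; rewrite ler_nat.
have AKU : \bigcup_k AK k = A.
  apply/seteqP; split => [w [k _ []]//|w Aw]; exists (Num.truncn (S w)).+1 => //; split => //=.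
  by apply: ltW; exact: truncnS_gt.
pose f w := potential rho (V w + C w) (M w + X w).
pose g w := potential rho (V w) (M w).
have tV i j : measurable_fun [set: T] (fun w => V w i j).
  exact: measurable_wrt_fun (mV i j).
have tM i : measurable_fun [set: T] (fun w => M w i ord0).
  exact: measurable_wrt_fun (mM i).
have tX i : measurable_fun [set: T] (fun w => X w i ord0).
  case: (hX i ord0) => iX _ _ _; apply/measurable_EFinP; exact: measurable_int iX.
have mf : measurable_fun [set: T] f.
  apply: measurable_potential => [|i j|i].
  - exact: measurable_cst.
  - exact: measurable_wrt_fun (mV' i j).
  - have -> : (fun w => (M w + X w) i ord0) = (fun w => M w i ord0 + X w i ord0).
      by apply/funext => w; rewrite mxE.
    exact: measurable_funD.
have mg : measurable_fun [set: T] g.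
  by apply: measurable_potential => //; exact: measurable_cst.
have f0 w : 0 <= f w by exact: potential_ge0.
have g0 w : 0 <= g w by exact: potential_ge0.
rewrite -[leLHS]/(\int[P]_(w in A) (f w)%:E)%E -[leRHS]/(\int[P]_(w in A) (g w)%:E)%E.
have step k : (\int[P]_(w in AK k) (f w)%:E <= \int[P]_(w in A) (g w)%:E)%E.
  pose a w : R := \1_(AK k) w.
  have a01 w : a w = 0 \/ a w = 1 /\ AK k w.
    rewrite /a indicE; case: (boolP (w \in AK k)) => [/set_mem h|_]; [by right|by left].
  have ga : measurable_fun [set: g_sigma_algebraType G] a.
    apply: measurable_indic; rewrite -(measurable_sub_sigma hG) in GAK; exact: GAK.
  have ta : measurable_fun [set: T] a by exact: measurable_indic.
  have bound (xi : T -> R) : measurable_fun [set: g_sigma_algebraType G] xi ->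
      (forall w, `|xi w| <= S w) ->
      measurable_wrt G (fun w => a w * xi w) /\ forall w, `|a w * xi w| <= k%:R.
    move=> mxi xiS; split; first by apply/(measurable_wrtP hG); exact: measurable_funM.
    move=> w; case: (a01 w) => [->|[-> [_ Sw]]]; first by rewrite mul0r normr0.
    by rewrite mul1r (le_trans (xiS w)).
  have p00 w : 0 <= p0 w by exact: potential_ge0.
  have sl w : 0 <= \sum_i `|lin i w| by rewrite sumr_ge0.
  have sq w : 0 <= \sum_(p : 'I_d * 'I_d) `|quad p.1 p.2 w| by rewrite sumr_ge0.
  have [mp0 bp0] : measurable_wrt G (fun w => a w * p0 w) /\ forall w, `|a w * p0 w| <= k%:R.
    apply: bound => // w; rewrite ger0_norm// /S -addrA lerDl addr_ge0//.
  have blin i : measurable_wrt G (fun w => a w * lin i w) /\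
      forall w, `|a w * lin i w| <= k%:R.
    apply: bound => // w; apply: (@le_trans _ _ (\sum_i `|lin i w|)).
      by rewrite (bigD1 i)//= lerDl sumr_ge0.
    by rewrite /S; have := p00 w; have := sq w; lra.
  have bquad (p : 'I_d * 'I_d) : measurable_wrt G (fun w => a w * quad p.1 p.2 w) /\
      forall w, `|a w * quad p.1 p.2 w| <= k%:R.
    apply: bound => // w; apply: (@le_trans _ _ (\sum_(p : 'I_d * 'I_d) `|quad p.1 p.2 w|)).
      by rewrite [leRHS](bigD1 p)//= lerDl sumr_ge0.
    by rewrite /S; have := p00 w; have := sl w; lra.
  have hlin i := cond_exp_version_pull_out hG Gm (hX i ord0) (blin i).1 (blin i).2.
  have hquad (p : 'I_d * 'I_d) :=
    cond_exp_version_pull_out hG Gm (hC p.1 p.2) (bquad p).1 (bquad p).2.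
  have iaC (p : 'I_d * 'I_d) :
      P.-integrable [set: T] (fun w => (a w * quad p.1 p.2 w * C w p.1 p.2)%:E).
    have [_ _ iC _] := hC p.1 p.2.
    have := @integrableMr _ _ _ P setT measurableT _ _
      (measurable_wrt_fun hG Gm (bquad p).1) _ iC.
    apply; exists k%:R; split => // x kx w _ /=.
    exact: le_trans ((bquad p).2 w) (ltW kx).
  have ip0 : P.-integrable [set: T] (EFin \o (fun w => a w * p0 w)).
    apply: measurable_bounded_integrable => //.
    - by rewrite (@le_lt_trans _ _ 1%E) ?probability_le1 ?ltry.
    - exact: measurable_wrt_fun mp0.
    - exists k%:R; split => // x kx w _ /=; exact: le_trans (bp0 w) (ltW kx).
  (* The truncated majorant is U + U1 + U2 + U3: U + U1 is its value after conditioning, U2 and U3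
     are the centred linear and quadratic parts, with integral 0. *)
  pose U w := (a w * p0 w)%:E.
  pose U1 w := (\sum_(p : 'I_d * 'I_d) (a w * quad p.1 p.2 w * C w p.1 p.2)%:E)%E.
  pose U2 w := (\sum_i (a w * lin i w * (X w i ord0 - (0 : 'cV[R]_d) i ord0))%:E)%E.
  pose U3 w := (\sum_(p : 'I_d * 'I_d)
    (a w * quad p.1 p.2 w * ((X w *m (X w)^T) p.1 p.2 - C w p.1 p.2))%:E)%E.
  have iU1 : P.-integrable [set: T] U1 by apply: integrable_sum.
  have iU2 : P.-integrable [set: T] U2.
    by apply: integrable_sum => // i _; exact: (hlin i).1.
  have iU3 : P.-integrable [set: T] U3.
    by apply: integrable_sum => // p _; exact: (hquad p).1.
  have intU2 : (\int[P]_w U2 w = 0)%E.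
    rewrite /U2 integral_sum//; last by move=> i; exact: (hlin i).1.
    by rewrite big1// => i _; exact: (hlin i).2.
  have intU3 : (\int[P]_w U3 w = 0)%E.
    rewrite /U3 integral_sum//; last by move=> p; exact: (hquad p).1.
    by rewrite big1// => p _; exact: (hquad p).2.
  have iUU1 : P.-integrable [set: T] (U \+ U1)%E by exact: integrableD.
  have iU23 : P.-integrable [set: T] (U2 \+ U3)%E by exact: integrableD.
  have iall : P.-integrable [set: T] ((U \+ U1) \+ (U2 \+ U3))%E by exact: integrableD.
  have intall : (\int[P]_w ((U \+ U1) \+ (U2 \+ U3)) w = \int[P]_w (U \+ U1) w)%E.
    rewrite integralD// [X in (_ + X)%E]integralD//.
    by rewrite [X in (_ + (X + _))%E]intU2 [X in (_ + (_ + X))%E]intU3 !adde0.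
  have UU1E w : (U \+ U1)%E w =
      (a w * (p0 w + \sum_i \sum_j quad i j w * C w i j))%:E.
    rewrite /U /U1 /= sumEFin -EFinD; congr EFin.
    rewrite mulrDr; congr (_ + _); rewrite pair_bigA/= big_distrr/=.
    by apply: eq_bigr => p _; rewrite mulrA.
  have allE w : ((U \+ U1) \+ (U2 \+ U3))%E w =
      (a w * (p0 w + \sum_i lin i w * X w i ord0 +
        \sum_i \sum_j quad i j w * (X w i ord0 * X w j ord0)))%:E.
    have -> : ((U \+ U1) \+ (U2 \+ U3))%E w =
        ((a w * (p0 w + \sum_i \sum_j quad i j w * C w i j))%:E + (U2 w + U3 w))%E.
      by rewrite -UU1E.
    rewrite /U2 /U3 !sumEFin -!EFinD.
    congr EFin; rewrite !pair_bigA/=.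
    have -> : \sum_i a w * lin i w * (X w i ord0 - (0 : 'cV[R]_d) i ord0) =
      a w * \sum_i lin i w * X w i ord0.
      by rewrite big_distrr; apply: eq_bigr => i _; rewrite mxE subr0 /= mulrA.
    have -> : \sum_(p : 'I_d * 'I_d) a w * quad p.1 p.2 w *
        ((X w *m (X w)^T) p.1 p.2 - C w p.1 p.2) =
      a w * (\sum_(p : 'I_d * 'I_d) quad p.1 p.2 w * (X w p.1 ord0 * X w p.2 ord0)) -
      a w * \sum_(p : 'I_d * 'I_d) quad p.1 p.2 w * C w p.1 p.2.
      rewrite !big_distrr/= -sumrB; apply: eq_bigr => p _; rewrite XE; ring.
    ring.
  have afE w : ((EFin \o f) \_ (AK k)) w = (a w * f w)%:E.
    by rewrite epatch_indic /= -EFinM mulrC.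
  rewrite [leLHS]integral_mkcond.
  apply: (@le_trans _ _ (\int[P]_w ((U \+ U1) \+ (U2 \+ U3)) w)%E).
    apply: ae_ge0_le_integrable => //.
    - apply/(measurable_restrictT _ (mAK k)); apply: measurable_funS (_ : measurable_fun setT _) => //.
      exact/measurable_EFinP.
    - by move=> w; rewrite afE lee_fin; case: (a01 w) => [->|[-> _]]; rewrite ?mul0r ?mul1r.
    apply: filterS3 X1 Vpsd Cpsd => w /= x1 vp cp.
    rewrite [leLHS]afE [leRHS]allE lee_fin.
    case: (a01 w) => [->|[-> _]]; first by rewrite !mul0r.
    rewrite !mul1r; exact: (potential_increment (M w) r0 (psdmxD vp cp) x1).
  rewrite intall.
  apply: (@le_trans _ _ (\int[P]_w ((EFin \o g) \_ (AK k)) w)%E).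
    have agE w : ((EFin \o g) \_ (AK k)) w = (a w * g w)%:E.
      by rewrite epatch_indic /= -EFinM mulrC.
    apply: ae_integrable_le_ge0 => //.
    - apply/(measurable_restrictT _ (mAK k)); apply: measurable_funS (_ : measurable_fun setT _) => //.
      exact/measurable_EFinP.
    - by move=> w; rewrite agE lee_fin; case: (a01 w) => [->|[-> _]]; rewrite ?mul0r ?mul1r.
    apply: filterS2 Vpsd Cpsd => w /= vp cp.
    rewrite [leLHS]UU1E [leRHS]agE lee_fin.
    case: (a01 w) => [->|[-> _]]; first by rewrite !mul0r.
    rewrite !mul1r; exact: potential_compensator.
  rewrite -integral_mkcond; apply: ge0_subset_integral => //.
  - by apply/measurable_EFinP; apply: measurable_funS mg.
  - by move=> w _; rewrite lee_fin.
  - by move=> w [].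
have cv := @ge0_nondecreasing_set_cvg_integral _ T R AK (EFin \o f) P AKnd mAK.
rewrite AKU in cv; apply: cvge_le (cv _ _).
- by apply: nearW => k; exact: step.
- by move=> i; apply/measurable_EFinP; apply: measurable_funS mf.
- by move=> i w _; rewrite /= lee_fin.
Qed.

End OneStep.

(** * Ville's maximal inequality for nonnegative supermartingales *)

Section Ville.
Context {disp : measure_display} {T : measurableType disp} {R : realType}.
Variables (P : probability T R) (F : nat -> set (set T)).
Hypothesis hF : filtration F.
Variable Y : nat -> T -> \bar R.
Hypothesis mY : forall n, measurable_fun [set: g_sigma_algebraType (F n)]
  (Y n : g_sigma_algebraType (F n) -> \bar R).
Hypothesis Y0 : forall n w, (0 <= Y n w)%E.
Hypothesis Ysuper : forall n A, F n A ->
  (\int[P]_(w in A) Y n.+1 w <= \int[P]_(w in A) Y n w)%E.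
Hypothesis Yint : (\int[P]_w Y 0 w <= 1)%E.

Lemma markov_split (B : set T) (Z : T -> \bar R) (l : R) : measurable B ->
  measurable_fun [set: T] Z -> (forall w, 0 <= Z w)%E -> 0 < l ->
  (l%:E * P (B `\` [set w | Z w < l%:E]) + \int[P]_(w in B `&` [set w | Z w < l%:E]) Z w <=
   \int[P]_(w in B) Z w)%E.
Proof.
move=> mB mZ Z0 l0; set D := [set w | _].
have mD : measurable D.
  have -> : D = [set: T] `&` Z @^-1` `]-oo, l%:E[%classic.
    by apply/seteqP; split => w; rewrite /D/= in_itv/= => // -[].
  by apply: mZ => //; exact: emeasurable_itv.
have mBD : measurable (B `\` D) by exact: measurableD.
have mBI : measurable (B `&` D) by exact: measurableI.
rewrite -[in leRHS](setDUK (@subIsetl _ B D)) setDIr setDv set0U setUC.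
rewrite ge0_integral_setU//; last 2 first.
- exact: measurable_funS mZ.
- by apply/disj_setPS => w [[_ nD] [_ Dw]].
rewrite leeD2r// -integral_cst//.
apply: ge0_le_integral => //.
- by move=> w _; rewrite lee_fin ltW.
- exact: measurable_funS mZ.
- by move=> w [_ /negP]; rewrite /D /= -leNgt.
Qed.

(** [B N] is the event that level [l] has not been reached by time [N]. The induction [main] bounds
    the expectation of the process frozen at that crossing, without stopping times. *)
Lemma ville_inequality (l : R) : 0 < l ->
  (P (\bigcup_n [set w | l%:E <= Y n w]) <= (l^-1)%:E)%E.
Proof.
move=> l0; case: hF => sF mF incF.
pose D n := [set w | Y n w < l%:E]%E.
pose B N := [set w | forall k, (k <= N)%N -> D k w].
have BS N : B N.+1 = B N `&` D N.+1.
  apply/seteqP; split => [w h|w [h1 h2] k]; first by split; [move=> k kN; apply: h; exact: leqW|exact: h].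
  by rewrite leq_eqVlt ltnS => /predU1P[->|/h1].
have B0 : B 0%N = D 0%N.
  by apply/seteqP; split => [w h|w h k]; [exact: h|rewrite leqn0 => /eqP ->].
have FD n : F n (D n).
  rewrite -(measurable_sub_sigma (sF n)).
  have -> : D n = [set: g_sigma_algebraType (F n)] `&` Y n @^-1` `]-oo, l%:E[%classic.
    by apply/seteqP; split => w; rewrite /D/= in_itv/= => // -[].
  by apply: mY => //; exact: emeasurable_itv.
have FB N : F N (B N).
  elim: N => [|N IH]; first by rewrite B0.
  rewrite BS -(measurable_sub_sigma (sF N.+1)); apply: measurableI; rewrite measurable_sub_sigma//.
  exact: incF IH.
have mYT n : measurable_fun [set: T] (Y n) by apply: (measurable_sub_fun (sF n) (mF n)); exact: mY.
have mB N : measurable (B N) by exact: (mF N).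
have main N : (l%:E * P (~` B N) + \int[P]_(w in B N) Y N w <= 1)%E.
  elim: N => [|N IH].
    have := @markov_split setT _ l measurableT (mYT 0%N) (Y0 0%N) l0.
    by rewrite setTD setTI -/(D 0%N) B0 => h; exact: le_trans Yint.
  have := @markov_split _ _ l (mB N) (mYT N.+1) (Y0 N.+1) l0.
  rewrite -/(D N.+1) -BS => h.
  have -> : P (~` B N.+1) = (P (~` B N) + P (B N `\` D N.+1))%E.
    rewrite -measureU//.
    - congr (P _); rewrite BS; apply/seteqP; split => w /=.
        by case: (pselect (B N w)) => ?; [right; split => // ?; apply: H|left].
      by move=> [h1 [/h1]|[h1 h2] [_ /h2]].
    - exact: measurableC.
    - apply: measurableD => //; exact: mF.
    - by apply/seteqP; split => w //= -[h1 [/h1]].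
  rewrite ge0_muleDr// -addeA; apply: le_trans IH; rewrite leeD2l//.
  by apply: le_trans h _; exact: Ysuper.
have PB N : (P (~` B N) <= (l^-1)%:E)%E.
  rewrite -(@lee_pmul2l _ l%:E)// -EFinM divff ?lt0r_neq0//.
  by apply: le_trans (main N); rewrite leeDl// integral_ge0.
have -> : \bigcup_n [set w | l%:E <= Y n w]%E = \bigcup_N (~` B N).
  apply/seteqP; split => w [n _ /= h]; last first.
    move/existsNP: h => [k /not_implyP[kn]]; rewrite /D /= => /negP; rewrite -leNgt => h.
    by exists k.
  exists n => // h'; have := h' n (leqnn n); rewrite /D /= ltNge h//.
have cv : P \o (fun N => ~` B N) @ \oo --> P (\bigcup_N (~` B N)).
  apply: nondecreasing_cvg_mu.
  - by move=> N; exact: measurableC.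
  - by apply: bigcup_measurable => N _; exact: measurableC.
  - move=> N N' NN'; apply/subsetPset; apply: subsetC => w h k kN; apply: h.
    exact: leq_trans NN'.
by apply: cvge_le cv; apply: nearW => N; exact: PB.
Qed.

End Ville.

(** * Mixing the potentials over rho *)

Section Mixture.
Context {disp : measure_display} {T : measurableType disp} {R : realType}.
Variables (pi : probability (measurableTypeR R) R) (P : probability T R).

(** The value 0 for [rho <= 0], a set that [pi] does not charge in the application, lets the mixture
    be an integral over the whole line. *)
Definition pos_potential d (rho : R) (V : 'M[R]_d) (m : 'cV[R]_d) : R :=
  if 0 < rho then potential rho V m else 0.

Definition mixture d (V : 'M[R]_d) (m : 'cV[R]_d) : \bar R :=
  (\int[pi]_rho (pos_potential rho V m)%:E)%E.

Lemma pos_potential_ge0 d rho (V : 'M[R]_d) m : 0 <= pos_potential rho V m.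
Proof. by rewrite /pos_potential; case: ifP => // _; exact: potential_ge0. Qed.

Lemma mixture_ge0 d (V : 'M[R]_d) m : (0 <= mixture V m)%E.
Proof. by apply: integral_ge0 => rho _; rewrite lee_fin pos_potential_ge0. Qed.

Lemma measurable_pos_potential d' (U : measurableType d') d (rho : U -> R)
    (V : U -> 'M[R]_d) (m : U -> 'cV[R]_d) :
  measurable_fun [set: U] rho ->
  (forall i j, measurable_fun [set: U] (fun w => V w i j)) ->
  (forall i, measurable_fun [set: U] (fun w => m w i ord0)) ->
  measurable_fun [set: U] (fun w => pos_potential (rho w) (V w) (m w)).
Proof.
move=> mr mV mm; apply: measurable_fun_ifT => //.
  by apply: measurable_fun_ltr => //; exact: measurable_cst.
exact: measurable_potential.
Qed.

Lemma measurable_pair_potential d' (U : measurableType d') d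
    (V : U -> 'M[R]_d) (m : U -> 'cV[R]_d) :
  (forall i j, measurable_fun [set: U] (fun w => V w i j)) ->
  (forall i, measurable_fun [set: U] (fun w => m w i ord0)) ->
  measurable_fun [set: measurableTypeR R * U]
    (fun z => pos_potential z.1 (V z.2) (m z.2)).
Proof.
move=> mV mm; apply: measurable_pos_potential.
- exact: measurable_fst.
- by move=> i j; apply: (measurableT_comp (mV i j)); exact: measurable_snd.
- by move=> i; apply: (measurableT_comp (mm i)); exact: measurable_snd.
Qed.

Lemma measurable_mixture d' (U : measurableType d') d
    (V : U -> 'M[R]_d) (m : U -> 'cV[R]_d) :
  (forall i j, measurable_fun [set: U] (fun w => V w i j)) ->
  (forall i, measurable_fun [set: U] (fun w => m w i ord0)) ->
  measurable_fun [set: U] (fun w => mixture (V w) (m w)).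
Proof.
move=> mV mm.
have := @measurable_fun_fubini_tonelli_G _ _ (measurableTypeR R) U R pi
  (fun z => (pos_potential z.1 (V z.2) (m z.2))%:E).
apply; first by apply/measurable_EFinP; exact: measurable_pair_potential.
by move=> z; rewrite lee_fin pos_potential_ge0.
Qed.

Lemma integral_mixture d A (V : T -> 'M[R]_d) (m : T -> 'cV[R]_d) : measurable A ->
  (forall i j, measurable_fun [set: T] (fun w => V w i j)) ->
  (forall i, measurable_fun [set: T] (fun w => m w i ord0)) ->
  (\int[P]_(w in A) mixture (V w) (m w) =
   \int[pi]_rho \int[P]_(w in A) (pos_potential rho (V w) (m w))%:E)%E.
Proof.
move=> mA mV mm.
pose f (z : measurableTypeR R * T) := (\1_A z.2 * pos_potential z.1 (V z.2) (m z.2))%:E.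
have f0 z : (0 <= f z)%E by rewrite lee_fin mulr_ge0// pos_potential_ge0.
have mf : measurable_fun [set: measurableTypeR R * T] f.
  apply/measurable_EFinP; apply: measurable_funM; last exact: measurable_pair_potential.
  by apply: (measurableT_comp _ measurable_snd); exact: measurable_indic.
have := @fubini_tonelli _ _ (measurableTypeR R) T R pi P f mf f0.
have -> : (\int[pi]_x \int[P]_y f (x, y) =
    \int[pi]_rho \int[P]_(w in A) (pos_potential rho (V w) (m w))%:E)%E.
  apply: eq_integral => rho _; rewrite [RHS]integral_mkcond; apply: eq_integral => w _.
  by rewrite epatch_indic /f /= -EFinM mulrC.
move=> ->; rewrite [LHS]integral_mkcond; apply: eq_integral => w _.
rewrite epatch_indic /f /=.
under eq_integral do rewrite EFinM.
rewrite ge0_integralZl//.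
- by rewrite muleC.
- apply/measurable_EFinP; apply: measurable_pos_potential => //; exact: measurable_cst.
- by move=> rho _; rewrite lee_fin pos_potential_ge0.
Qed.

Lemma measurable_integral_potential d A (V : T -> 'M[R]_d) (m : T -> 'cV[R]_d) :
  measurable A ->
  (forall i j, measurable_fun [set: T] (fun w => V w i j)) ->
  (forall i, measurable_fun [set: T] (fun w => m w i ord0)) ->
  measurable_fun [set: measurableTypeR R]
    (fun rho => \int[P]_(w in A) (pos_potential rho (V w) (m w))%:E)%E.
Proof.
move=> mA mV mm.
have -> : (fun rho => \int[P]_(w in A) (pos_potential rho (V w) (m w))%:E)%E =
  (fun rho => \int[P]_w (\1_A w * pos_potential rho (V w) (m w))%:E)%E.
  apply/funext => rho; rewrite [LHS]integral_mkcond; apply: eq_integral => w _.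
  by rewrite epatch_indic /= -EFinM mulrC.
have := @measurable_fun_fubini_tonelli_F _ _ (measurableTypeR R) T R P
  (fun z => (\1_A z.2 * pos_potential z.1 (V z.2) (m z.2))%:E).
apply.
  apply/measurable_EFinP; apply: measurable_funM; last exact: measurable_pair_potential.
  by apply: (measurableT_comp _ measurable_snd); exact: measurable_indic.
by move=> z; rewrite lee_fin mulr_ge0// pos_potential_ge0.
Qed.

Lemma mixture00 d : pi `]0, +oo[%classic = 1%E -> mixture (0 : 'M[R]_d) 0 = 1%E.
Proof.
move=> hpi; rewrite -hpi -[X in pi X]setIT -integral_indic//.
apply: eq_integral => rho _; congr EFin; rewrite /pos_potential indicE.
rewrite mem_setE in_itv/= andbT; case: ifP => // r0.
rewrite /potential /scaled_norm /qform bform0r sqrtr0 mul0r bennett0 mulr0 expR0.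
by rewrite /regmx scaler0 addr0 det1 sqrtr1 divr1.
Qed.

Variables (d : nat) (F : nat -> set (set T)).
Hypothesis hF : filtration F.
Variable M : nat -> T -> 'cV[R]_d.
Hypothesis hM : martingale P F M.
Hypothesis hM0 : {ae P, forall w, M 0%N w = 0}.
Hypothesis hX0 : forall n, (1 <= n)%N ->
  cond_exp_version_mx P (F n.-1) (increment M n) (fun=> 0).
Hypothesis hX1 : forall n, (1 <= n)%N -> {ae P, forall w, enorm (increment M n w) <= 1}.
Variable C : nat -> T -> 'M[R]_d.
Hypothesis hC : forall i, (1 <= i)%N ->
  cond_exp_version_mx P (F i.-1)
    (fun w => increment M i w *m (increment M i w)^T) (C i).
Variable V : nat -> T -> 'M[R]_d.
Hypothesis hV : forall n w, V n w = \sum_(1 <= i < n.+1) C i w.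

Lemma ae_psdmx_variation : {ae P, forall w, forall n, psdmx (V n w)}.
Proof.
case: hF => sF mF _.
have hc : {ae P, forall w, forall n, (fun n w => psdmx (C n.+1 w)) n w}.
  by apply: ae_foralln => n; exact: (ae_psdmx (sF n) (mF n) (@hC n.+1 isT)).
apply: filterS hc => w /= h n; rewrite hV.
elim: n => [|n IH]; first by rewrite big_geq//; exact: psdmx0.
by rewrite big_nat_recr//=; exact: psdmxD.
Qed.

Lemma measurable_wrt_variation n i j : measurable_wrt (F n) (fun w => V n w i j).
Proof.
case: hF => sF mF incF; apply/(measurable_wrtP (sF n)).
have -> : (fun w => V n w i j) = (fun w => \sum_(k < n) C k.+1 w i j).
  by apply/funext => w; rewrite hV summxE big_add1/= big_mkord.
apply: measurable_sum => k; apply/(measurable_wrtP (sF n)) => B mB.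
have [_ mC _ _] := @hC k.+1 isT i j.
by apply: (incF k n (ltnW (ltn_ord k))); exact: mC.
Qed.

Lemma measurable_variation n i j : measurable_fun [set: T] (fun w => V n w i j).
Proof.
case: hF => sF mF _.
exact: (measurable_wrt_fun (sF n) (mF n) (measurable_wrt_variation n i j)).
Qed.

Lemma measurable_martingale n i : measurable_fun [set: T] (fun w => M n w i ord0).
Proof.
case: hF => sF mF _; case: hM => mM _ _.
exact: (measurable_wrt_fun (sF n) (mF n) (mM n i)).
Qed.

(** Tonelli's theorem puts the integral over [rho] outside, so the one-step inequality is needed
    only for one [rho] at a time and null sets may depend on it. *)
Lemma mixture_supermartingale n A : F n A ->
  (\int[P]_(w in A) mixture (V n.+1 w) (M n.+1 w) <=
   \int[P]_(w in A) mixture (V n w) (M n w))%E.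
Proof.
move=> FA; have [sF mF incF] := hF; have [mM _ _] := hM.
have mA := mF n A FA.
have mV k := @measurable_variation k; have mMT k := @measurable_martingale k.
have intE k := integral_mixture mA (mV k) (mMT k).
have mint k := measurable_integral_potential mA (mV k) (mMT k).
have int0 k rho : (0 <= \int[P]_(w in A) (pos_potential rho (V k w) (M k w))%:E)%E.
  by apply: integral_ge0 => w _; rewrite lee_fin pos_potential_ge0.
rewrite [leLHS](intE n.+1) [leRHS](intE n).
apply: ge0_le_integral.
- exact: measurableT.
- by move=> rho _; exact: int0.
- exact: mint.
- exact: mint.
move=> rho _; have [r0|r0] := ltP 0 rho; last first.
  have z k : (\int[P]_(w in A) (pos_potential rho (V k w) (M k w))%:E = 0)%E.
    by apply: integral0_eq => w _; rewrite /pos_potential ltNge r0.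
  by rewrite (z n.+1) (z n).
have Mrec w : M n.+1 w = M n w + increment M n.+1 w by rewrite /increment/= addrC subrK.
have Vrec w : V n.+1 w = V n w + C n.+1 w by rewrite !hV big_nat_recr.
have -> : (\int[P]_(w in A) (pos_potential rho (V n.+1 w) (M n.+1 w))%:E =
    \int[P]_(w in A) (potential rho (V n w + C n.+1 w) (M n w + increment M n.+1 w))%:E)%E.
  by apply: eq_integral => w _; rewrite /pos_potential r0 Mrec Vrec.
have -> : (\int[P]_(w in A) (pos_potential rho (V n w) (M n w))%:E =
    \int[P]_(w in A) (potential rho (V n w) (M n w))%:E)%E.
  by apply: eq_integral => w _; rewrite /pos_potential r0.
apply: (@potential_supermartingale _ _ _ P (F n) (sF n) (mF n)).
- exact: mM.
- exact: measurable_wrt_variation.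
- exact: (@hX0 n.+1 isT).
- exact: (@hC n.+1 isT).
- exact: (@hX1 n.+1 isT).
- by apply: filterS ae_psdmx_variation => w; exact.
- exact: r0.
- exact: FA.
Qed.

Lemma mixture_maximal (hpi : pi `]0, +oo[%classic = 1%E) (l : R) : 0 < l ->
  (P (\bigcup_n [set w | l%:E <= mixture (V n w) (M n w)]%E) <= (l^-1)%:E)%E.
Proof.
move=> l0; have [sF mF incF] := hF; have [mM _ _] := hM.
have gV n i j := (measurable_wrtP (sF n) _).1 (measurable_wrt_variation n i j).
have gM n i := (measurable_wrtP (sF n) _).1 (mM n i).
apply: (@ville_inequality _ _ _ P F hF (fun n w => mixture (V n w) (M n w)) _ _ _ _ l l0).
- by move=> n; apply: measurable_mixture => [i j|i]; [exact: gV|exact: gM].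
- by move=> n w; exact: mixture_ge0.
- exact: mixture_supermartingale.
have int1 : (\int[P]_w (cst 1 : T -> \bar R) w = 1)%E.
  by rewrite integral_cst// mul1e; exact: probability_setT.
rewrite -[leRHS]int1 le_eqVlt; apply/orP; left; apply/eqP.
apply: ae_eq_integral.
- exact: measurableT.
- apply: measurable_mixture; [exact: measurable_variation|exact: measurable_martingale].
- exact: measurable_cst.
apply: filterS hM0 => w /= -> _.
by rewrite hV big_geq// mixture00.
Qed.

End Mixture.

(** * From a bounded mixture to the explicit bound *)

Section FinalBound.
Variable R : realType.

(** The monotonicities conflict: N shrinks as [rho] grows, so the quadratic form and the determinant
    are taken at the left end [a], whereas rho h(w / rho) decreases and is taken at the right end
    [b]. The ratio of the ends is what puts [u] in the bound. *)
Lemma potential_lower_bound d (V : 'M[R]_d) m (a b rho : R) : psdmx V ->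
  0 < a -> a <= rho -> rho <= b ->
  expR (b * bennett (Num.sqrt (qform (invmx (regmx a V)) m) / b)) /
    Num.sqrt (\det (regmx a V)) <= potential rho V m.
Proof.
move=> Vp a0 ar rb; have r0 : 0 < rho := lt_le_trans a0 ar.
have Nap := pdmx_regmx a0 Vp; have Nrp := pdmx_regmx r0 Vp.
have dp : psdmx ((a^-1 - rho^-1) *: V).
  by apply: psdmxZ => //; rewrite subr_ge0 lef_pV2.
have NE : regmx a V = regmx rho V + (a^-1 - rho^-1) *: V.
  by rewrite /regmx -addrA -scalerDl addrCA subrr addr0.
have qle : qform (invmx (regmx a V)) m <= qform (invmx (regmx rho V)) m.
  apply: qform_invmx_antitone => // x.
  by rewrite NE /qform bformDm lerDl; exact: (psdmx_qform x dp).
have qge0 : 0 <= qform (invmx (regmx a V)) m.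
  exact: (psdmx_qform _ (pdmx_psd (pdmx_inv Nap))).
rewrite /potential /scaled_norm cramer_invE ?pdmx_unit//.
apply: ler_pM; rewrite ?expR_ge0 ?invr_ge0 ?sqrtr_ge0//.
  rewrite ler_expR; apply: le_trans (bennett_perspective r0 rb (sqrtr_ge0 _)) _.
  rewrite ler_pM2l//; apply: bennett_homo; first by rewrite divr_ge0 ?sqrtr_ge0 ?ltW.
  by rewrite ler_pM2r ?invr_gt0// ler_sqrt// (le_trans qge0).
rewrite lef_pV2 ?posrE ?sqrtr_gt0 ?pdmx_det_gt0//.
by rewrite ler_sqrt ?(ltW (pdmx_det_gt0 Nap))// NE; exact: pdmx_det_homo.
Qed.

Lemma qform_invmx_sqrt d (V S : 'M[R]_d) m : V \in unitmx -> S^T = S -> S *m S = V ->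
  qform 1%:M (invmx S *m m) = qform (invmx V) m.
Proof.
move=> Vu Ss SS.
have Su : S \in unitmx by move: Vu; rewrite -SS unitmx_mul => /andP[].
have -> : invmx V = (invmx S)^T *m invmx S.
  rewrite trmx_inv Ss; apply: (can_inj (mulKmx Vu)).
  rewrite [LHS]mulmxV// -[X in X *m (_ *m _)]SS -mulmxA mulKVmx//.
  by rewrite mulmxV.
by rewrite /qform /bform mulmx1 trmx_mul !mulmxA.
Qed.

Lemma enorm_inv_sqrtmx_le d (V : 'M[R]_d) m : pdmx V ->
  enorm (inv_sqrtmx V *m m) <= Num.sqrt (qform (invmx V) m).
Proof.
move=> Vp; rewrite enormE ler_wsqrtr// /inv_sqrtmx /sqrtmx.
have q0 : 0 <= qform (invmx V) m by exact: (psdmx_qform _ (pdmx_psd (pdmx_inv Vp))).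
case: xgetP => [? _ [[Ss _] SS]|_].
  by rewrite (qform_invmx_sqrt _ (pdmx_unit Vp) Ss SS).
(* No square root: [sqrtmx V] is 0, and so is its [invmx]. *)
rewrite (_ : qform _ _ = 0)//; case: d V m Vp q0 => [|d] V m Vp q0.
  by rewrite qform1E big_ord0.
have -> : invmx (0 : 'M[R]_d.+1) = 0.
  by rewrite /invmx unitmxE det0 unitr0.
by rewrite mul0mx /qform bform0r.
Qed.

Lemma mixture_bound (pi : probability (measurableTypeR R) R) d (V : 'M[R]_d) m (y r u : R) :
  psdmx V -> (mixture pi V m < (expR y)%:E)%E -> 0 < lambda_min V -> 0 < r -> 1 < u ->
  let L := Lbound pi V y r u in
  ((enorm (inv_sqrtmx V *m m))%:E <=
    (Num.sqrt (1 + r))%:E *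
      (sqrte ((2 * u)%:E * L)
       + L * ((3 * Num.sqrt (r * lambda_min V))^-1)%:E))%E.
Proof.
move=> Vp mix l0 r0 u1; rewrite /Lbound /Delta.
set a := r * lambda_min V.
have a0 : 0 < a by rewrite mulr_gt0.
have u0 : 0 < u by lra.
have s1r : 0 < Num.sqrt (1 + r) by rewrite sqrtr_gt0; lra.
have sa0 : 0 < Num.sqrt a by rewrite sqrtr_gt0.
have mI : measurable (`[a, (u * a)%R]%classic : set (measurableTypeR R)) by exact: measurable_itv.
set I := (`[a, (u * a)%R]%classic : set (measurableTypeR R)) in mI *.
have pifin : pi I \is a fin_num by exact: fin_num_measure.
have [p0|p_neq0] := eqVneq (pi I) 0%E.
  rewrite p0 le0_lneNy// (_ : (- -oo = +oo :> \bar R)%E)// addey// addye// gt0_muley; last by rewrite lte_fin mulr_gt0.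
  rewrite gt0_mulye; last by rewrite lte_fin invr_gt0 mulr_gt0.
  by rewrite addye// gt0_muley ?lte_fin// leey.
pose p := fine (pi I).
have pE : pi I = p%:E by rewrite fineK.
have p0 : 0 < p.
  by rewrite -lte_fin -pE lt0e p_neq0 measure_ge0.
have Nap := pdmx_regmx a0 Vp.
have det0 := pdmx_det_gt0 Nap.
rewrite -/(regmx a V) pE lne_EFin// -EFinN -!EFinD.
set l := y - ln p + _.
pose w := Num.sqrt (qform (invmx (regmx a V)) m).
have w0 : 0 <= w by exact: sqrtr_ge0.
pose N := u * a * bennett (w / (u * a)).
have ua0 : 0 < u * a by rewrite mulr_gt0.
have N0 : 0 <= N.
  by rewrite mulr_ge0 ?(ltW ua0)// bennett_ge0// divr_ge0// ltW.
have Nl : N < l.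
  have : ((expR N / Num.sqrt (\det (regmx a V)) * p)%:E < (expR y)%:E)%E.
    apply: le_lt_trans mix.
    rewrite EFinM -pE -integral_cst// /mixture.
    rewrite [leLHS]integral_mkcond; apply: ge0_le_integral => //.
    - move=> rho _; apply: erestrict_ge0 => x _.
      by rewrite lee_fin divr_ge0 ?expR_ge0 ?sqrtr_ge0.
    - by apply/(measurable_restrictT _ mI); exact: measurable_cst.
    - apply/measurable_EFinP.
      by apply: measurable_pos_potential => [|i j|i]; [exact: measurable_id|exact: measurable_cst|exact: measurable_cst].
    move=> rho _; rewrite patchE; case: ifPn => [/set_mem|_]; last by rewrite lee_fin pos_potential_ge0.
    rewrite /I /= in_itv/= => /andP[h1 h2]; rewrite /pos_potential (lt_le_trans a0 h1) lee_fin.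
    exact: potential_lower_bound.
  have q0 : 0 < expR N / Num.sqrt (\det (regmx a V)).
    by rewrite divr_gt0 ?expR_gt0// sqrtr_gt0.
  have lnE : ln (expR N / Num.sqrt (\det (regmx a V)) * p) =
      N - 2^-1 * ln (\det (regmx a V)) + ln p.
    rewrite [LHS](@lnM _ _ _ q0 p0) ln_div ?posrE ?expR_gt0 ?sqrtr_gt0// expRK.
    by rewrite -powR12_sqrt ?(ltW det0)// ln_powR.
  rewrite lte_fin => lt_exp.
  have : ln (expR N / Num.sqrt (\det (regmx a V)) * p) < ln (expR y).
    by rewrite ltr_ln ?posrE ?expR_gt0// (mulr_gt0 q0 p0).
  rewrite lnE expRK.
  rewrite /l; lra.
have l_ge0 : 0 <= l by lra.
have ws : w <= Num.sqrt a * (Num.sqrt (2 * u * l) + l / (3 * Num.sqrt a)).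
  (* Multiplied by [u * a], the inversion reads w <= sqrt (2 u a N) + N / 3; then [N < l] and a
     factor sqrt a is taken out. *)
  have := @bennett_inversion R (w / (u * a)).
  rewrite divr_ge0 ?(ltW ua0)// => /(_ isT); rewrite -(@ler_pM2l _ (u * a))//.
  rewrite [leLHS]mulrC divfK ?lt0r_neq0// => h; apply: le_trans h _.
  rewrite mulrDr [leRHS]mulrDr; apply: lerD; last first.
    have -> : u * a * (bennett (w / (u * a)) / 3) = N / 3 by rewrite /N; ring.
    have -> : Num.sqrt a * (l / (3 * Num.sqrt a)) = l / 3 by field; rewrite lt0r_neq0.
    by rewrite ler_pM2r// ltW.
  rewrite -{1}[u * a]ger0_norm ?(ltW ua0)// -sqrtr_sqr -!sqrtrM ?sqr_ge0 ?(ltW a0)//.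
  apply: ler_wsqrtr.
  have -> : (u * a) ^+ 2 * (2 * bennett (w / (u * a))) = 2 * (u * a) * N by rewrite /N; ring.
  have -> : a * (2 * u * l) = 2 * (u * a) * l by ring.
  by rewrite ler_pM2l ?mulr_gt0// ltW.
have lam x : lambda_min V * qform 1%:M x <= qform V x by exact: psdmx_lambda_min_le.
have Vpd : pdmx V.
  split; first exact: Vp.1.
  by move=> x x0; apply: lt_le_trans (lam x); rewrite mulr_gt0//; exact: (@pdmx1 _ _).2.
have qV : Num.sqrt (qform (invmx V) m) <= Num.sqrt (1 + r) * (w / Num.sqrt a).
  (* With this factor, [k *: regmx a V] is (a I + V) / (1 + r), which is at most V since a I <= r
     V. *)
  pose k := a / (1 + r).
  have k0 : 0 < k by rewrite divr_gt0//; lra.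
  have kNp : pdmx (k *: regmx a V).
    split; first by rewrite linearZ/= Nap.1.
    by move=> x x0; rewrite /qform bformZm mulr_gt0//; exact: Nap.2.
  have : qform (invmx V) m <= qform (invmx (k *: regmx a V)) m.
    apply: qform_invmx_antitone => // x.
    rewrite /qform bformZm bformDm bformZm mulrDr mulrA.
    have -> : k * a^-1 = (1 + r)^-1 by rewrite /k; field; rewrite !lt0r_neq0//; lra.
    have := lam x; rewrite /qform => lamx.
    have -> : k * bform 1%:M x x = r / (1 + r) * (lambda_min V * bform 1%:M x x).
      by rewrite /k /a; field; rewrite lt0r_neq0//; lra.
    rewrite [leRHS](_ : _ = r / (1 + r) * bform V x x + (1 + r)^-1 * bform V x x); last first.
      by field; rewrite lt0r_neq0//; lra.
    by rewrite lerD2r ler_pM2l// divr_gt0//; lra.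
  rewrite invmxZ ?unitfE ?lt0r_neq0 ?pdmx_unit// /qform bformZm -/(qform _ _) => h.
  have -> : Num.sqrt (1 + r) * (w / Num.sqrt a) =
      Num.sqrt ((1 + r) / a * qform (invmx (regmx a V)) m).
    have ra0 : 0 <= (1 + r) / a by rewrite divr_ge0 ?(ltW a0)//; lra.
    rewrite [RHS]sqrtrM// [X in _ = X * _]sqrtrM; last lra.
    by rewrite sqrtrV ?(ltW a0)// mulrA mulrAC.
  by apply: ler_wsqrtr; move: h; rewrite /k invf_div.
(* With [l] finite, the extended-real expression reduces to this real one by computation. *)
rewrite -[leRHS]/((Num.sqrt (1 + r) *
  (Num.sqrt (2 * u * l) + l / (3 * Num.sqrt a)))%:E) lee_fin.
apply: le_trans (enorm_inv_sqrtmx_le m Vpd) _; apply: le_trans qV _.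
by rewrite ler_pM2l// ler_pdivrMr// mulrC.
Qed.

End FinalBound.

Theorem mainTheorem8 (R : realType)
  (pi : probability (measurableTypeR R) R)
  (hpi : pi `]0, +oo[%classic = 1%E)
  (disp : measure_display) (T : measurableType disp) (P : probability T R)
  (d : nat) (hd : (1 <= d)%N)
  (F : nat -> set (set T)) (hF : filtration F)
  (M : nat -> T -> 'cV[R]_d) (hM : martingale P F M)
  (hM0 : {ae P, forall w, M 0%N w = 0})
  (hX0 : forall n, (1 <= n)%N ->
     cond_exp_version_mx P (F n.-1) (increment M n) (fun=> 0))
  (hX1 : forall n, (1 <= n)%N -> {ae P, forall w, enorm (increment M n w) <= 1})
  (C : nat -> T -> 'M[R]_d)
  (hC : forall i, (1 <= i)%N ->
     cond_exp_version_mx P (F i.-1)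
       (fun w => increment M i w *m (increment M i w)^T) (C i))
  (V : nat -> T -> 'M[R]_d)
  (hV : forall n w, V n w = \sum_(1 <= i < n.+1) C i w)
  (y : R) (hy : 0 <= y) :
  exists E : set T,
    [/\ measurable E,
        ((1 - expR (- y))%:E <= P E)%E &
        forall w, E w ->
        forall n, (1 <= n)%N -> 0 < lambda_min (V n w) ->
        forall r u : R, 0 < r -> 1 < u ->
        let L := Lbound pi (V n w) y r u in
        ((enorm (inv_sqrtmx (V n w) *m M n w))%:E <=
          (Num.sqrt (1 + r))%:E *
            (sqrte ((2 * u)%:E * L)
             + L * ((3 * Num.sqrt (r * lambda_min (V n w)))^-1)%:E))%E].
Proof.
have [N [mN PN0 Npsd]] := ae_psdmx_variation hF hC hV.
(* Neither [r] nor [u] enters [B]: outside it, and outside the null set [N] where positivity may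
   fail, the bound holds for all of them simultaneously. *)
pose B := \bigcup_n [set w | (expR y)%:E <= mixture pi (V n w) (M n w)]%E.
have mB : measurable B.
  apply: bigcup_measurable => n _.
  rewrite (_ : [set w | _] = [set: T] `&`
    (fun w => mixture pi (V n w) (M n w)) @^-1` `[(expR y)%:E, +oo[%classic); last first.
    by apply/seteqP; split => w /=; rewrite in_itv/= andbT => // -[].
  apply: measurable_mixture => [i j|i||]; last exact: emeasurable_itv.
  - exact: (measurable_variation hF hC hV).
  - exact: (measurable_martingale hF hM).
  - exact: measurableT.
have mBN : measurable (B `|` N) by exact: measurableU.
exists (~` (B `|` N)); split; first exact: measurableC.
  rewrite probability_setC// EFinB leeB//.
  apply: (@le_trans _ _ (P B + P N)%E); first exact: measureU2.
  rewrite [X in (_ + X)%E]PN0 adde0 expRN.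
  exact: (mixture_maximal hF hM hM0 hX0 hX1 hC hV hpi (expR_gt0 y)).
move=> w /not_orP[nB nN] n n1 l0 r u r0 u1; apply: mixture_bound => //.
  by apply: contrapT => h; apply: nN; apply: Npsd => /(_ n).
by rewrite ltNge; apply/negP => h; apply: nB; exists n.
Qed.
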